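(* Let $K=\mathbb F_3(t)$, let $c=\dfrac{t^2+t+2}{t(t+1)^2}\in K$, and consider the twisted Carlitz module $\rho_t^c(x)=tx+cx^3$. Then the adelic Galois representation attached to $\rho_t^c$ is surjective.
   Context: For a prime power $q$, $K=\mathbb F_q(t)$ and $c\in K^\times$, the twisted Carlitz module $\rho^c$ is the rank-one Drinfeld $\mathbb F_q[t]$-module over $K$ determined by $\rho_t^c(x)=tx+cx^q$; that is, $N\mapsto\rho^c_N(x)$ is the $\mathbb F_q$-algebra homomorphism from $\mathbb F_q[t]$ to the ring of $\mathbb F_q$-linear polynomials over $K$ (under addition and composition) sending $t$ to $\rho_t^c$. For nonconstant $N\in\mathbb F_q[t]$, the roots of $\rho^c_N(x)$ in $K^{\mathrm{sep}}$ form a free $\mathbb F_q[t]/(N)$-module of rank one, giving a representation $\operatorname{Gal}(K^{\mathrm{sep}}/K)\to(\mathbb F_q[t]/(N))^\times$. The adelic Galois representation is the inverse limit over all $N$, $\operatorname{Gal}(K^{\mathrm{sep}}/K)\to\widehat{\mathbb F_q[t]}^{\times}=\varprojlim_N(\mathbb F_q[t]/(N))^\times$. Here $q=3$. *)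

(* Defs.v *)
From HB Require Import structures.
From mathcomp Require Import all_boot all_order all_algebra all_fingroup.
From mathcomp Require Import all_solvable all_field.
From Stdlib Require Import ClassicalEpsilon ProofIrrelevance.
From Stdlib Require Import FunctionalExtensionality.

Set Implicit Arguments.
Unset Strict Implicit.
Unset Printing Implicit Defensive.

Import GRing.Theory.
Local Open Scope ring_scope.

Definition separable_closure (K L : fieldType) (iota : {rmorphism K -> L}) :=
  (forall x : L, exists2 p : {poly K},
     separable_poly p & root (map_poly iota p) x) /\
  (forall p : {poly L},
     separable_poly p -> (1 < size p)%N -> exists x, root p x).

Record galois_group (K L : fieldType) (iota : {rmorphism K -> L}) := Galois {
  gal_fun :> {rmorphism L -> L};
  gal_bij : bijective gal_fun;
  gal_fix : forall k, gal_fun (iota k) = iota k }.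

Section ResidueRings.

Variable F : finFieldType.

Definition modulus := {N : {poly F} | (1 < size N)%N}.

(* {poly %/ h} is F[t]/(h) only for h monic and nonconstant, so N is first made
   monic; this does not change the ideal. *)
Definition monic_modulus (N : modulus) : {poly F} :=
  (lead_coef (val N))^-1 *: val N.

Notation residue_ring N := {poly %/ monic_modulus N}.

Definition residue (N : modulus) (a : {poly F}) : residue_ring N :=
  in_qpoly (monic_modulus N) a.

Definition lift_residue (N : modulus) (a : residue_ring N) : {poly F} := val a.

(* The unit group of lim_N F[t]/(N), the limit being over all nonconstant N
   ordered by divisibility. *)
Record profinite_units := ProfiniteUnits {
  component : forall N : modulus, residue_ring N;
  component_unit : forall N, component N \is a GRing.unit;
  component_compat : forall M N : modulus, val M %| val N ->
    residue M (lift_residue (component N)) = component M }.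

Lemma profinite_units_eq (a b : profinite_units) :
  (forall N, component a N = component b N) -> a = b.
Proof.
case: a b => [a ua ca] [b ub cb] /= eq_ab.
have E : a = b by apply: functional_extensionality_dep.
by subst b; congr ProfiniteUnits; exact: proof_irrelevance.
Qed.

Lemma lead_modulus (N : modulus) : lead_coef (val N) != 0.
Proof.
by case: N => N /= hN; rewrite lead_coef_eq0 -size_poly_gt0 (ltn_trans _ hN).
Qed.

Lemma mk_monic_modulus (N : modulus) :
  mk_monic (monic_modulus N) = monic_modulus N.
Proof.
have l0 := lead_modulus N; case: N l0 => N /= hN l0.
rewrite /mk_monic /monic_modulus /= size_scale ?invr_eq0 // hN.
by rewrite monicE lead_coefZ mulVf ?eqxx.
Qed.

Lemma residue_eq (N : modulus) a b :
  residue N a = residue N b <-> val N %| a - b.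
Proof.
have mon := monic_mk_monic (monic_modulus N).
have -> : (val N %| a - b) =
    (Pdiv.CommonRing.rmodp (a - b) (mk_monic (monic_modulus N)) == 0).
  rewrite -Pdiv.IdomainMonic.modpE // mk_monic_modulus.
  by rewrite /monic_modulus -[RHS]/(_ %| _) dvdpZl ?invr_eq0 ?lead_modulus.
rewrite Pdiv.RingMonic.rmodpB // subr_eq0; split=> [E|/eqP E].
  by move/(congr1 val): E => /= ->.
exact: val_inj.
Qed.

Lemma lift_residueK (N : modulus) : cancel (@lift_residue N) (residue N).
Proof.
move=> a; apply: val_inj; apply: Pdiv.CommonRing.rmodp_small.
exact: size_mk_monic.
Qed.

Lemma residueM (N : modulus) a b :
  residue N (a * b) = residue N a * residue N b.
Proof. exact: in_qpolyM. Qed.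

Lemma residue1 (N : modulus) : residue N 1 = 1.
Proof. exact: in_qpoly1. Qed.

Lemma lift_residue_dvd (N : modulus) a : val N %| lift_residue (residue N a) - a.
Proof. by apply/residue_eq; rewrite lift_residueK. Qed.

Lemma card_residue_ring (N : modulus) :
  #|{: residue_ring N}| = (#|F| ^ (size (val N)).-1)%N.
Proof.
rewrite card_qpoly mk_monic_modulus /monic_modulus size_scale // invr_eq0.
exact: lead_modulus.
Qed.

Lemma irreducible_divisor (M : {poly F}) :
  (1 < size M)%N -> exists2 P, irreducible_poly P & P %| M.
Proof.
have [n] := ubnP (size M); elim: n M => // n IH M /ltnSE-leMn sM.
have [/irreducibleP irrM | ] := boolP (irreducibleb M); first by exists M.
rewrite /irreducibleb sM /= => /forallPn [q].
rewrite negb_imply -Pdiv.Idomain.dvdpE -ltnNge => /andP[qM sq].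
have [|P irrP Pq] := IH q _ sq; last by exists P => //; apply: dvdp_trans qM.
apply: leq_ltn_trans (size_npoly q) _.
by rewrite (leq_trans _ leMn) // prednK // (ltn_trans _ sM).
Qed.

End ResidueRings.

Notation residue_ring N := {poly %/ monic_modulus N}.

Section TwistedCarlitz.

(* theta is the structure map of K; below, K is F(t) and theta the inclusion. *)
Variables (F : finFieldType) (K : fieldType) (theta : {rmorphism {poly F} -> K}).
Variable c : K.
Implicit Types M N D : {poly F}.

Definition carlitz_t : {poly K} := theta 'X *: 'X + c *: 'X^#|F|.

(* The F-algebra homomorphism from F[t] to the ring of F-linear polynomials
   under addition and composition that sends t to carlitz_t; see carlitzD,
   carlitzC, carlitzM and carlitzX. *)
Definition carlitz (N : {poly F}) : {poly K} :=
  \sum_(i < size N)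
     theta (N`_i)%:P *: iter i (fun f => f \Po carlitz_t) 'X.

Local Notation q := #|F|.

Lemma q_gt1 : (1 < q)%N. Proof. exact: finNzRing_gt1. Qed.

Lemma q_pnat (R : comNzRingType) (f : {rmorphism F -> R}) : [pchar R].-nat q.
Proof.
have [p pr_p pF] := finPcharP F; rewrite (card_pprimeChar pF).
have pR : p \in [pchar R] by apply: rmorph_pchar pF.
by rewrite pnatX (eq_pnat _ (pcharf_eq pR)) pnat_id // orbT.
Qed.

Lemma natr_q (R : nzRingType) (f : {rmorphism F -> R}) : q%:R = 0 :> R.
Proof.
rewrite -(rmorph_nat f) -FinRing.zmodXgE -cardsT expg_cardG ?inE //.
exact: rmorph0.
Qed.

Hypothesis theta_inj : injective theta.
Hypothesis c_neq0 : c != 0.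

Let theta_eq0 a : (theta a == 0) = (a == 0).
Proof. by rewrite -(rmorph0 theta) (inj_eq theta_inj). Qed.

Lemma size_carlitz_t : size carlitz_t = q.+1.
Proof.
rewrite /carlitz_t addrC size_polyDl (@size_scale _ c) // size_polyXn //.
by rewrite (leq_ltn_trans (size_scale_leq _ _)) // size_polyX ltnS q_gt1.
Qed.

Lemma deriv_carlitz_t : carlitz_t^`() = (theta 'X)%:P.
Proof.
rewrite derivD !derivZ derivX derivXn -mulr_natr
        (natr_q (polyC \o theta \o polyC)) mulr0 scaler0 addr0.
exact: alg_polyC.
Qed.

Local Notation ct i := (iter i (fun f => f \Po carlitz_t) 'X).

Lemma size_iter_carlitz_t i : size (ct i) = (q ^ i).+1.
Proof.
suff E : (size (ct i)).-1 = (q ^ i)%N.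
  by rewrite -E prednK // ltnNge leqn0; apply/negP => /eqP s0;
     move: E; rewrite s0 => /esym/eqP; rewrite expn_eq0 (gtn_eqF (ltnW q_gt1)).
elim: i => [|i IH]; first by rewrite size_polyX.
by rewrite iterS size_comp_poly IH size_carlitz_t expnSr.
Qed.

Lemma deriv_iter_carlitz_t i : (ct i)^`() = (theta 'X ^+ i)%:P.
Proof.
elim: i => [|i IH]; first by rewrite derivX.
by rewrite iterS deriv_comp IH deriv_carlitz_t comp_polyC -polyCM exprSr.
Qed.

Lemma deriv_carlitz N : (carlitz N)^`() = (theta N)%:P.
Proof.
rewrite /carlitz raddf_sum -[in RHS](coefK N) poly_def !rmorph_sum /=.
apply: eq_bigr => i _; rewrite derivZ deriv_iter_carlitz_t.
by rewrite -(mul_polyC N`_i) (rmorphM theta) (rmorphXn theta) -mul_polyC -polyCM.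
Qed.

Lemma size_carlitz N : N != 0 -> size (carlitz N) = (q ^ (size N).-1).+1.
Proof.
move=> N0; rewrite /carlitz; move: (N0); rewrite -lead_coef_eq0 lead_coefE.
have : (0 < size N)%N by rewrite size_poly_gt0.
case: (size N) => // n _ /= ln0; rewrite big_ord_recr /= addrC size_polyDl.
  by rewrite size_scale ?theta_eq0 ?polyC_eq0 // size_iter_carlitz_t.
rewrite size_scale ?theta_eq0 ?polyC_eq0 // size_iter_carlitz_t ltnS.
apply: leq_trans (size_sum _ _ _) _; apply/bigmax_leqP => i _.
apply: leq_trans (size_scale_leq _ _) _; rewrite size_iter_carlitz_t.
by rewrite ltn_exp2l ?q_gt1.
Qed.

Section Action.

Variables (R : comNzRingType) (iota : {rmorphism K -> R}).

Definition carlitz_act (N : {poly F}) (x : R) : R :=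
  (map_poly iota (carlitz N)).[x].

Local Notation act := carlitz_act.
Local Notation s a := (iota (theta a%:P)).

Let map_ct x : (map_poly iota carlitz_t).[x] = iota (theta 'X) * x + iota c * x ^+ q.
Proof. by rewrite /carlitz_t rmorphD /= !map_polyZ /= map_polyX map_polyXn !hornerE. Qed.

Let phi0 x := iota (theta 'X) * x + iota c * x ^+ q.

Let map_iter i x : (map_poly iota (ct i)).[x] = iter i phi0 x.
Proof.
elim: i x => [|i IH] x; first by rewrite map_polyX hornerX.
by rewrite iterS map_comp_poly horner_comp IH map_ct -iterSr.
Qed.

Let actE n N x : (size N <= n)%N -> act N x = \sum_(i < n) s N`_i * iter i phi0 x.
Proof.
move=> leNn; rewrite /act /carlitz rmorph_sum horner_sum /=.
rewrite (big_ord_widen _ (fun i => (map_poly iota (theta (N`_i)%:P *: ct i)).[x]) leNn).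
rewrite big_mkcond; apply: eq_bigr => i _; rewrite map_polyZ hornerZ map_iter.
by case: ltnP => // /(nth_default 0) ->; rewrite !rmorph0 mul0r.
Qed.

Lemma carlitz_actD M N x : act (M + N) x = act M x + act N x.
Proof.
pose n := maxn (size M) (size N).
rewrite (@actE n) ?size_polyD // (@actE n M) ?leq_maxl //.
rewrite (@actE n N) ?leq_maxr //.
rewrite -big_split; apply: eq_bigr => i _ /=.
by rewrite coefD !rmorphD mulrDl.
Qed.

Let phi0D x y : phi0 (x + y) = phi0 x + phi0 y.
Proof.
rewrite /phi0 exprDn_pchar ?(q_pnat (iota \o theta \o polyC)) //.
by rewrite !mulrDr addrACA.
Qed.

Let phi0s a x : phi0 (s a * x) = s a * phi0 x.
Proof.
rewrite /phi0 exprMn -!rmorphXn expf_card /= mulrDr.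
by rewrite ![s a * (_ * _)]mulrCA.
Qed.

Let iter_phi0D i x y : iter i phi0 (x + y) = iter i phi0 x + iter i phi0 y.
Proof. by elim: i => //= i ->. Qed.

Lemma carlitz_act_additive N x y : act N (x + y) = act N x + act N y.
Proof.
rewrite !(actE _ (leqnn _)) -big_split; apply: eq_bigr => i _ /=.
by rewrite iter_phi0D mulrDr.
Qed.

Lemma carlitz_act0 N : act N 0 = 0.
Proof. by apply: (addrI (act N 0)); rewrite -carlitz_act_additive !addr0. Qed.

Lemma carlitz_actr0 x : act 0 x = 0.
Proof. by apply: (addrI (act 0 x)); rewrite -carlitz_actD !addr0. Qed.

Lemma carlitz_actN N x : act (- N) x = - act N x.
Proof.
by apply: (addrI (act N x)); rewrite -carlitz_actD !subrr carlitz_actr0.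
Qed.

Lemma carlitz_actB M N x : act (M - N) x = act M x - act N x.
Proof. by rewrite carlitz_actD carlitz_actN. Qed.

Lemma carlitz_actC a x : act a%:P x = s a * x.
Proof. by rewrite (@actE 1) ?size_polyC ?leq_b1 // big_ord1 coefC. Qed.

Lemma carlitz_act1 x : act 1 x = x.
Proof. by rewrite -[1]polyC1 carlitz_actC !rmorph1 mul1r. Qed.

Let actMX N x : act (N * 'X) x = act N (phi0 x).
Proof.
rewrite (@actE (size N).+1); last first.
  by rewrite (leq_trans (size_polyMleq _ _)) // size_polyX addn2.
rewrite big_ord_recl coefMX eqxx !rmorph0 mul0r add0r (actE _ (leqnn _)).
by apply: eq_bigr => i _; rewrite coefMX /= -iterSr.
Qed.

Let phi0_act N x : phi0 (act N x) = act N (phi0 x).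
Proof.
rewrite !(actE _ (leqnn _)) (big_morph _ phi0D (_ : phi0 0 = 0)).
  by apply: eq_bigr => i _; rewrite phi0s -iterS iterSr.
by rewrite /phi0 expr0n (gtn_eqF (ltnW q_gt1)) !mulr0 addr0.
Qed.

Let actCM a N x : act (a%:P * N) x = s a * act N x.
Proof.
rewrite mul_polyC (@actE (size N)) ?size_scale_leq // (actE _ (leqnn _)).
rewrite mulr_sumr; apply: eq_bigr => i _.
by rewrite coefZ polyCM !rmorphM mulrA.
Qed.

Lemma carlitz_actM M N x : act (M * N) x = act M (act N x).
Proof.
elim/poly_ind: M x => [|M a IH] x; first by rewrite mul0r !carlitz_actr0.
rewrite mulrDl !carlitz_actD actCM carlitz_actC; congr (_ + _).
by rewrite mulrAC !actMX IH phi0_act.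
Qed.

End Action.

Lemma carlitzD M N : carlitz (M + N) = carlitz M + carlitz N.
Proof. by have := carlitz_actD polyC M N 'X; rewrite ![carlitz_act _ _ _]comp_polyXr. Qed.

Lemma carlitzC a : carlitz a%:P = theta a%:P *: 'X.
Proof.
have := carlitz_actC polyC a 'X; rewrite [carlitz_act _ _ _]comp_polyXr => ->.
by rewrite mul_polyC.
Qed.

Lemma carlitzM M N : carlitz (M * N) = carlitz M \Po carlitz N.
Proof. by have := carlitz_actM polyC M N 'X; rewrite ![carlitz_act _ _ 'X]comp_polyXr. Qed.

Lemma carlitzX : carlitz 'X = carlitz_t.
Proof.
by rewrite /carlitz size_polyX !big_ord_recl big_ord0 !coefX /= !rmorph0 scale0r
  !rmorph1 scale1r add0r addr0 comp_polyX.
Qed.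

Section Torsion.

Variables (L : fieldType) (iota : {rmorphism K -> L}).

Definition torsion (N : {poly F}) : pred L :=
  root (map_poly iota (carlitz N)).

Lemma torsionE N x : torsion N x = (carlitz_act iota N x == 0).
Proof. by []. Qed.

Local Notation act := (carlitz_act iota).

Lemma galois_act (sigma : galois_group iota) N x :
  sigma (act N x) = act N (sigma x).
Proof.
rewrite /act -horner_map -map_poly_comp; congr (_.[_]).
by apply: eq_map_poly => k /=; rewrite gal_fix.
Qed.

Hypothesis hL : separable_closure iota.

Lemma carlitz_separable N y :
  N != 0 -> separable_poly (map_poly iota (carlitz N) - y%:P).
Proof.
move=> N0; rewrite unlock derivB derivC subr0 deriv_map.
rewrite deriv_carlitz.
rewrite map_polyC /= -(alg_polyC (iota _)) coprimepZr ?coprimep1 //.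
by rewrite fmorph_eq0 theta_eq0.
Qed.

Lemma carlitz_act_surj N y : N != 0 -> exists x, act N x = y.
Proof.
move=> N0; have [|x] := hL.2 _ (carlitz_separable y N0).
  have q_gt0 : (0 < q)%N := ltnW q_gt1.
  rewrite size_polyDl size_map_poly size_carlitz // ltnS ?expn_gt0 ?q_gt0 //.
  rewrite size_polyN (leq_trans (size_polyC_leq1 _)) //.
  by rewrite expn_gt0 q_gt0.
by rewrite rootE !hornerE subr_eq0 => /eqP; exists x.
Qed.

Lemma torsion_nontrivial N :
  (1 < size N)%N -> exists2 x, x != 0 & act N x = 0.
Proof.
move=> sN; have N0 : N != 0 by rewrite -size_poly_gt0 (ltn_trans _ sN).
have sep := carlitz_separable 0 N0; rewrite subr0 in sep.
have /factor_theorem[g gE] : root (map_poly iota (carlitz N)) 0.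
  by rewrite rootE -/(act N 0) carlitz_act0.
rewrite subr0 in gE; have g0 : g.[0] != 0.
  have := congr1 (fun p => p^`().[0]) gE.
  rewrite deriv_map deriv_carlitz map_polyC derivM derivX !hornerE /=.
  by move=> <-; rewrite fmorph_eq0 theta_eq0.
have [||x] := hL.2 g.
- by apply: dvdp_separable sep; rewrite gE dvdp_mulr.
- have gn0 : g != 0 by apply: contraNneq g0 => ->; rewrite horner0.
  have := congr1 (fun p => size (polyseq p)) gE.
  rewrite size_mulX // size_map_poly size_carlitz // => -[<-].
  rewrite -[1%N](expn0 q) ltn_exp2l ?q_gt1 //.
  by case: (size N) sN => [|[]].
rewrite rootE => /eqP gx; exists x.
  by apply: contraNneq g0 => x0; rewrite -{1}x0 gx.
by rewrite /act gE hornerM gx mul0r.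
Qed.

Lemma torsion_generator N :
  N != 0 -> exists lambda, forall D, act D lambda = 0 <-> N %| D.
Proof.
have [n] := ubnP (size N); elim: n N => // n IH N /ltnSE-leNn N0.
case: (ltnP 1 (size N)) => [sN|sN]; last first.
  exists 0 => D; rewrite carlitz_act0; split => // _.
  have /size_poly1P[a a0 ->] : size N == 1%N.
    by rewrite eqn_leq sN size_poly_gt0.
  by rewrite -alg_polyC dvdpZl // dvd1p.
have [P irrP PN] := irreducible_divisor sN.
have [sP _] := irrP; have P0 : P != 0 by rewrite -size_poly_gt0 (ltn_trans _ sP).
have /dvdpP[M NE] := PN; have M0 : M != 0.
  by apply: contraNneq N0 => M0; rewrite NE M0 mul0r.
have sM : (size M < size N)%N.
  rewrite NE size_mul //; case: (size P) sP => [|[|k]] // _.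
  by rewrite !addnS /= ltnS leq_addr.
have [mu muP] := IH M (leq_trans sM leNn) M0.
have cop D y : act P y = 0 -> act D y = 0 -> ~~ (P %| D) -> y = 0.
  move=> Py Dy; rewrite -irreducible_poly_coprime //.
  case/Bezout_eq1_coprimepP => -[u v] /= uv.
  by rewrite -(carlitz_act1 iota y) -uv carlitz_actD !carlitz_actM Py Dy !carlitz_act0 addr0.
have [x Px Mx] : exists2 x, act P x = mu & act M x != 0.
  have [x Px] := carlitz_act_surj mu P0.
  have [Mx|] := eqVneq (act M x) 0; last by exists x.
  have [y y0 Py] := torsion_nontrivial sP.
  have [PM|nPM] := boolP (P %| M).
    have /dvdpP[M2 M2E] := PM; exfalso.
    have : M %| M2 by apply/muP; rewrite -Px -carlitz_actM -M2E.
    have M20 : M2 != 0 by apply: contraNneq M0 => M20; rewrite M2E M20 mul0r.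
    move/(dvdp_leq M20); rewrite M2E size_mul // leqNgt.
    case: (size P) sP => [|[|k]] // _.
    by rewrite !addnS /= ltnS leq_addr.
  exists (x + y); first by rewrite carlitz_act_additive Px Py addr0.
  rewrite carlitz_act_additive Mx add0r; apply: contra_neq y0 => My.
  exact: cop nPM.
exists x => D; split => [Dx|/dvdpP[E ->]]; last first.
  rewrite NE carlitz_actM carlitz_actM Px.
  by rewrite (muP M).2 ?carlitz_act0 ?dvdpp.
have /dvdpP[E DE] : M %| D.
  by apply/muP; rewrite -Px -carlitz_actM mulrC carlitz_actM Dx carlitz_act0.
rewrite DE NE mulrC dvdp_mul2r //; apply: contraNT Mx => nPE; apply/eqP.
apply: cop nPE; last by rewrite -carlitz_actM -DE.
by rewrite -carlitz_actM mulrC carlitz_actM Px; apply/muP.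
Qed.

Lemma torsion_cyclic (N : modulus F) : exists2 lambda,
  (forall D, act D lambda = 0 <-> val N %| D) &
  (forall x, torsion (val N) x -> exists a, x = act a lambda).
Proof.
have N0 : val N != 0 by rewrite -lead_coef_eq0 lead_modulus.
have [lambda lamP] := torsion_generator N0; exists lambda => // x Nx.
pose rs := [seq act (lift_residue a) lambda | a : residue_ring N].
have [/imageP[a _ ->]|nx] := boolP (x \in rs); first by exists (lift_residue a).
have : (size (x :: rs) < size (map_poly iota (carlitz (val N))))%N.
  apply: max_poly_roots.
  - by rewrite -size_poly_gt0 size_map_poly size_carlitz.
  - rewrite /= [root _ x]Nx; apply/allP => _ /imageP[a _ ->].
    by rewrite -/(torsion _ _) torsionE -carlitz_actM; apply/eqP/lamP/dvdp_mulr.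
  - rewrite /= nx map_inj_uniq ?enum_uniq // => a b eq_ab.
    rewrite -[a]lift_residueK -[b]lift_residueK; apply/residue_eq/lamP.
    by rewrite carlitz_actB eq_ab subrr.
rewrite size_map_poly size_carlitz // /= size_image.
by rewrite [#|_|]card_residue_ring ltnn.
Qed.

Lemma torsion_act_eq (N : modulus F) a b :
  (forall x, torsion (val N) x -> act a x = act b x) <->
  residue N a = residue N b.
Proof.
rewrite residue_eq; split=> [eq_ab|/dvdpP[D abE] x Nx]; last first.
  apply/eqP; rewrite -subr_eq0 -carlitz_actB abE carlitz_actM.
  by move: Nx; rewrite torsionE => /eqP->; rewrite carlitz_act0.
have [lambda lamP _] := torsion_cyclic N.
apply/lamP; rewrite carlitz_actB eq_ab ?subrr // torsionE.
by apply/eqP/lamP.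
Qed.

Lemma galois_torsion (sigma : galois_group iota) N x :
  torsion N x -> torsion N (sigma x).
Proof. by rewrite !torsionE -galois_act => /eqP->; rewrite rmorph0. Qed.

Lemma galois_torsionV (sigma : galois_group iota) N y :
  torsion N y -> exists2 x, torsion N x & sigma x = y.
Proof.
have [g gK Kg] := gal_bij sigma; rewrite torsionE => /eqP Ny.
exists (g y); last exact: Kg.
rewrite torsionE -(inj_eq (can_inj gK)) galois_act [gal_fun _ _]Kg Ny.
by rewrite [gal_fun _ 0]rmorph0.
Qed.

Lemma torsion_char_exists (sigma : galois_group iota) (N : modulus F) :
  exists a : residue_ring N, a \is a GRing.unit /\
    (forall x, torsion (val N) x -> sigma x = act (lift_residue a) x).
Proof.
have [lambda lamP genP] := torsion_cyclic N.
have Nlam : torsion (val N) lambda by rewrite torsionE; apply/eqP/lamP.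
have [a aE] := genP _ (galois_torsion sigma Nlam).
have sigE x : torsion (val N) x -> sigma x = act a x.
  move=> /genP[b ->].
  by rewrite galois_act aE -!carlitz_actM mulrC.
have [y Ny yE] := galois_torsionV sigma Nlam.
have [b bE] := genP _ Ny.
exists (residue N a); split; last first.
  move=> x Nx; rewrite sigE //; apply/torsion_act_eq: x Nx.
  by rewrite lift_residueK.
apply/unitrPr; exists (residue N b); rewrite -residueM -residue1.
apply/residue_eq/lamP; rewrite carlitz_actB carlitz_act1 carlitz_actM -bE.
by rewrite -sigE // yE subrr.
Qed.

(* The residue class through which sigma acts on the N-torsion; it is unique by
   torsion_act_eq, because the torsion is free of rank one (torsion_cyclic). *)
Definition torsion_char (sigma : galois_group iota) (N : modulus F) :
    residue_ring N :=
  proj1_sig (constructive_indefinite_description _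
    (torsion_char_exists sigma N)).

Lemma torsion_char_unit (sigma : galois_group iota) (N : modulus F) :
  torsion_char sigma N \is a GRing.unit.
Proof.
exact: (proj1 (proj2_sig (constructive_indefinite_description _
  (torsion_char_exists sigma N)))).
Qed.

Lemma torsion_charP (sigma : galois_group iota) (N : modulus F) x :
  torsion (val N) x ->
  sigma x = act (lift_residue (torsion_char sigma N)) x.
Proof.
exact: (proj2 (proj2_sig (constructive_indefinite_description _
  (torsion_char_exists sigma N)))).
Qed.

Lemma torsion_char_compat (sigma : galois_group iota) (M N : modulus F) :
  val M %| val N ->
  residue M (lift_residue (torsion_char sigma N)) = torsion_char sigma M.
Proof.
move=> /dvdpP[D NE]; rewrite -[RHS]lift_residueK; apply/torsion_act_eq => x Mx.
rewrite -!torsion_charP // torsionE NE carlitz_actM.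
by move: Mx; rewrite torsionE => /eqP->; rewrite carlitz_act0.
Qed.

Definition adelic_representation (sigma : galois_group iota) :
    profinite_units F :=
  ProfiniteUnits (torsion_char_unit sigma) (@torsion_char_compat sigma).

End Torsion.

End TwistedCarlitz.

Section RationalFunctionField.

Variables (F : finFieldType) (c : {fraction {poly F}}) (c_neq0 : c != 0).
Variables (L : fieldType) (iota : {rmorphism {fraction {poly F}} -> L}).
Hypothesis hL : separable_closure iota.

Lemma tofrac_inj : injective (@tofrac {poly F}).
Proof. by move=> a b /eqP; rewrite tofrac_eq => /eqP. Qed.

Definition carlitz_adelic_representation :
    galois_group iota -> profinite_units F :=
  @adelic_representation F _ (@tofrac {poly F}) c tofrac_inj c_neq0 L iota hL.

End RationalFunctionField.

Section ExampleTwist.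

Local Notation t := (tofrac ('X : {poly 'F_3})).

Definition twist : {fraction {poly 'F_3}} :=
  (t ^+ 2 + t + 2%:R) / (t * (t + 1) ^+ 2).

Lemma twist_neq0 : twist != 0.
Proof.
have -> : twist = tofrac ('X ^+ 2 + 'X + 2%:R) / tofrac ('X * ('X + 1) ^+ 2).
  by rewrite !(rmorphD, rmorphM, rmorphXn, rmorph1, rmorph_nat).
rewrite mulf_neq0 ?invr_eq0 ?tofrac_eq0 //.
  apply/eqP => /(congr1 (fun p : {poly 'F_3} => p`_2)).
  rewrite !coefD coefXn coefX !coef1 coef0 /= !addr0 => /eqP.
  by rewrite oner_eq0.
by rewrite mulf_neq0 ?polyX_eq0 // expf_neq0 // -size_poly_eq0 -polyC1 size_XaddC.
Qed.

Lemma carlitz_t_twist :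
  carlitz_t (@tofrac {poly 'F_3}) twist = t *: 'X + twist *: 'X^3.
Proof. by rewrite /carlitz_t card_Fp. Qed.

End ExampleTwist.

(* Main.v *)
Require Import Defs.
From HB Require Import structures.
From mathcomp Require Import all_boot all_order all_algebra all_field.
From mathcomp Require Import classical_sets ring.
From Stdlib Require Import Classical ClassicalEpsilon.

(* Let C be the Carlitz module (c = 1), kappa its adelic character, and i a square
   root of -1. The twist has a square root u = i w with w in the field generated by
   the Carlitz torsion: up to squares of K, w^2 = -tQ with Q = t^2 + t + 2, where
   sqrt(-t) is t-torsion and sqrt(Q) is the product of half of the nonzero
   Q-torsion. As u rho^c_N(x) = C_N(u x), it suffices to find an automorphism with
   kappa(sigma) = a and sigma(u) = u, and for this that (kappa, sigma(i) / i) takes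
   every value: two automorphisms with the same kappa and opposite values at i
   agree on w, so one of them fixes u.

   At level N this joint surjectivity is Dedekind's proof of the irreducibility of
   the cyclotomic polynomials: since C_P(x) is congruent to x^|P| modulo P, for a
   monic prime P outside a finite set lambda |-> C_P(lambda), i |-> (-1)^(deg P) i
   preserves the polynomial relations between a torsion point lambda and i. Every
   class of units modulo N contains monic polynomials of both parities of degree
   prime to any given polynomial. The resulting isomorphism of the field generated
   by i and all the torsion extends to Ksep by Zorn's lemma. *)

Set Implicit Arguments.
Unset Strict Implicit.
Unset Printing Implicit Defensive.

Import GRing.Theory.
Local Open Scope ring_scope.

(** * Residue fields of F[X] *)

Section Residue.

Variables (F : finFieldType) (P : {poly F}).
Hypothesis hP : monic_irreducible_poly P.

Local Notation q := #|F|.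
Local Notation d := (size P).-1.
Local Notation Q := {poly %/ P with hP}.

Let r (a : {poly F}) : Q := in_qpoly P a.

Let rB a b : r (a - b) = r a - r b.
Proof. by rewrite /r raddfB. Qed.

Let rM a b : r (a * b) = r a * r b.
Proof. exact: in_qpolyM. Qed.

Let rX a n : r (a ^+ n) = r a ^+ n.
Proof. by elim: n => [|n IH]; [exact: in_qpoly1 | rewrite !exprS rM IH]. Qed.

Let r_eq0 a : (P %| a) = (r a == 0).
Proof.
rewrite -val_eqE /= mk_monicE // -Pdiv.IdomainMonic.modpE //; exact: hP.2.
Qed.

Lemma dvdp_exp_card a : P %| a ^+ (q ^ d) - a.
Proof. by rewrite r_eq0 rB rX subr_eq0 -(card_qfpoly hP) expf_card. Qed.

(** The power [q ^ i] is a ring endomorphism of F[X]/(P) fixing F and, by assumption, the class of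
    X, so it is the identity; then ['X^(q ^ i) - 'X] has [q ^ d] roots. *)
Lemma dvdp_expX_card i : P %| 'X^(q ^ i) - 'X -> (0 < i)%N -> (d <= i)%N.
Proof.
rewrite r_eq0 rB rX subr_eq0 => /eqP rXi i_gt0.
have qi1 : (1 < q ^ i)%N by rewrite -(expn0 q) ltn_exp2l ?q_gt1.
pose p : {poly Q} := 'X^(q ^ i) - 'X.
have sp : size p = (q ^ i).+1.
  by rewrite size_polyDl size_polyXn // size_polyN size_polyX ltnS.
have rootp (x : Q) : root p x.
  have -> : x = r (val x).
    apply: val_inj; rewrite /r /= Pdiv.CommonRing.rmodp_small //.
    exact: size_mk_monic.
  have rD a b : r (a + b) = r a + r b by rewrite /r raddfD.
  have pn : [pchar Q].-nat (q ^ i)%N.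
    by rewrite pnatX (q_pnat (GRing.in_alg Q)).
  rewrite /p rootE !hornerE subr_eq0; apply/eqP.
  elim/poly_ind: (val x : {poly F}) => [|a c IH].
    by rewrite -rX expr0n gtn_eqF // ltnW.
  rewrite rD rM exprDn_pchar // exprMn IH rXi; congr (_ + _).
  rewrite -rX -polyC_exp; congr (r _%:P).
  by elim: (i) => [|j IHj]; rewrite ?expr1 // expnSr exprM IHj expf_card.
rewrite -(leq_exp2l _ _ (q_gt1 F)) -(card_qfpoly hP) cardE.
have := @max_poly_roots _ p (enum Q) _ _ (enum_uniq _).
rewrite sp ltnS; apply; first by rewrite -size_poly_gt0 sp.
by apply/allP.
Qed.

End Residue.

(** * Coefficients of the Carlitz module *)

Section CarlitzCoefficients.

Variable F : finFieldType.
Implicit Types N P : {poly F}.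

Local Notation q := #|F|.

(* The coefficient of tau^j in (X + tau)^i, where tau is the q-power Frobenius. *)
Fixpoint carlitz_Xn_coef (i j : nat) : {poly F} :=
  if i is i'.+1 then
    'X * carlitz_Xn_coef i' j + (if j is j'.+1 then carlitz_Xn_coef i' j' ^+ q else 0)
  else (j == 0)%:R.

Local Notation ec := carlitz_Xn_coef.

(** The coefficient of x^(q^j) in C_N(x), kept in F[X] rather than in K so that divisibility by P
    makes sense. *)
Definition carlitz_coef N j : {poly F} := \sum_(i < size N) (N`_i)%:P * ec i j.

Lemma carlitz_Xn_coef_gt i j : (i < j)%N -> ec i j = 0.
Proof.
elim: i j => [|i IH] [|j] //= ltij; rewrite !IH ?(ltnW ltij) // mulr0 add0r.
by rewrite expr0n gtn_eqF // ltnW // q_gt1.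
Qed.

Lemma carlitz_Xn_coefnn i : ec i i = 1.
Proof. by elim: i => //= i ->; rewrite carlitz_Xn_coef_gt // mulr0 add0r expr1n. Qed.

Lemma carlitz_Xn_coef0 i : ec i 0 = 'X^i.
Proof. by elim: i => //= i ->; rewrite addr0 exprS. Qed.

Let polyF_q_pnat : [pchar {poly F}].-nat q.
Proof. exact: (q_pnat (@polyC F)). Qed.

(** Peels a factor X + tau off on the right instead of the left, using tau^j X = X^(q^j) tau^j. *)
Lemma carlitz_Xn_coefSr i j :
  ec i.+1 j = 'X^(q ^ j) * ec i j + (if j is j'.+1 then ec i j' else 0).
Proof.
elim: i j => [|i IH] j.
  rewrite /=; case: j => [|[|j]] /=; first by rewrite expn0 !addr0.
    by rewrite !mulr0 expr1n.
  by rewrite !mulr0 expr0n gtn_eqF // ltnW // q_gt1.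
have ecS j' : ec i.+1 j'.+1 = 'X * ec i j'.+1 + ec i j' ^+ q by [].
case: j => [|j]; first by rewrite -[LHS]/('X * ec i.+1 0 + 0) IH /= !addr0 mulrCA.
rewrite -[LHS]/('X * ec i.+1 j.+1 + ec i.+1 j ^+ q) [in X in X + _]IH [in X in _ + X]IH.
rewrite exprDn_pchar ?polyF_q_pnat // exprMn -exprM -expnSr ecS !mulrDr mulrCA -!addrA.
congr (_ + _); rewrite addrCA; congr (_ + _).
rewrite -[ec i.+1 j]/('X * ec i j + (if j is j'.+1 then ec i j' ^+ q else 0)).
by congr (_ + _); case: j => //=; rewrite expr0n gtn_eqF // ltnW // q_gt1.
Qed.

Lemma carlitz_coef0 N : carlitz_coef N 0 = N.
Proof.
rewrite -[RHS]coefK poly_def; apply: eq_bigr => i _.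
by rewrite carlitz_Xn_coef0 mul_polyC.
Qed.

Lemma carlitz_coef_lead N : N != 0 -> carlitz_coef N (size N).-1 = (lead_coef N)%:P.
Proof.
rewrite -size_poly_gt0 /carlitz_coef lead_coefE; case: (size N) => // n _.
rewrite big_ord_recr big1 /= => [|i _]; last by rewrite carlitz_Xn_coef_gt ?mulr0.
by rewrite add0r carlitz_Xn_coefnn mulr1.
Qed.

(* Compares the two sides of C_X C_N = C_N C_X. *)
Lemma carlitz_coef_rec N j :
  ('X^(q ^ j.+1) - 'X) * carlitz_coef N j.+1 = carlitz_coef N j ^+ q - carlitz_coef N j.
Proof.
apply/eqP; rewrite mulrBl subr_eq addrAC eq_sym subr_eq; apply/eqP.
transitivity (\sum_(i < size N) (N`_i)%:P * ec i.+1 j.+1).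
  rewrite addrC /carlitz_coef mulr_sumr.
  rewrite (big_morph (fun x => x ^+ q) (id1 := 0) (op1 := +%R)) /=; first last.
  - by rewrite expr0n gtn_eqF // ltnW // q_gt1.
  - by move=> x y; rewrite exprDn_pchar ?polyF_q_pnat.
  rewrite -big_split; apply: eq_bigr => i _ /=.
  by rewrite mulrDr mulrCA exprMn -polyC_exp expf_card.
rewrite /carlitz_coef mulr_sumr -big_split; apply: eq_bigr => i _.
by rewrite carlitz_Xn_coefSr mulrDr [in LHS]mulrCA.
Qed.

(** Induction along [carlitz_coef_rec]: P is prime to X^(q^(j+1)) - X as long as j + 1 is below the
    degree of P. *)
Lemma dvdp_carlitz_coef P j : irreducible_poly P -> P \is monic ->
  (j < (size P).-1)%N -> P %| carlitz_coef P j.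
Proof.
move=> irrP monP; elim: j => [|j IH] ltj; first by rewrite carlitz_coef0.
have hP : monic_irreducible_poly P by [].
have copP : coprimep P ('X^(q ^ j.+1) - 'X).
  rewrite irreducible_poly_coprime //; apply: contraL ltj => /(dvdp_expX_card hP)/(_ isT).
  by rewrite -leqNgt.
rewrite -(Gauss_dvdpr _ copP) carlitz_coef_rec dvdp_sub ?IH ?(ltnW ltj) //.
rewrite -(prednK (ltnW (q_gt1 F))) exprS dvdp_mulr //; exact/IH/ltnW.
Qed.

Section Action.

Variables (K : fieldType) (theta : {rmorphism {poly F} -> K}).
Variables (R : comNzRingType) (iota : {rmorphism K -> R}).

Local Notation act := (carlitz_act theta 1 iota).

Lemma carlitz_actX c x :
  carlitz_act theta c iota 'X x = iota (theta 'X) * x + iota c * x ^+ q.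
Proof.
rewrite /carlitz_act carlitzX /carlitz_t rmorphD /= !map_polyZ /=.
by rewrite map_polyX map_polyXn !hornerE.
Qed.

Let R_q_pnat : [pchar R].-nat q.
Proof. exact: (q_pnat (iota \o theta \o @polyC F)). Qed.

Lemma carlitz_actXn i x :
  act 'X^i x = \sum_(j < i.+1) iota (theta (ec i j)) * x ^+ (q ^ j).
Proof.
elim: i x => [|i IH] x.
  by rewrite big_ord1 carlitz_act1 /= !rmorph1 mul1r expn0 expr1.
rewrite exprS carlitz_actM carlitz_actX rmorph1 mul1r IH.
rewrite (big_morph (fun x => x ^+ q) (id1 := 0) (op1 := +%R)) /=; first last.
- by rewrite expr0n gtn_eqF // ltnW // q_gt1.
- by move=> y z; rewrite exprDn_pchar ?R_q_pnat.
under [RHS]eq_bigr => j _ do rewrite !rmorphD !rmorphM /= mulrDl.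
rewrite big_split /=; congr (_ + _).
  rewrite [RHS]big_ord_recr /= (@carlitz_Xn_coef_gt i) // !rmorph0 mulr0 mul0r addr0.
  by rewrite mulr_sumr; apply: eq_bigr => j _; rewrite mulrA.
rewrite [RHS]big_ord_recl /= !rmorph0 mul0r add0r; apply: eq_bigr => j _.
by rewrite exprMn -exprM -expnSr !rmorphXn.
Qed.

Lemma carlitz_actE N x :
  act N x = \sum_(j < size N) iota (theta (carlitz_coef N j)) * x ^+ (q ^ j).
Proof.
have actsum (I : Type) (s : seq I) (G : I -> {poly F}) :
    act (\sum_(i <- s) G i) x = \sum_(i <- s) act (G i) x.
  apply: (big_morph (fun M => act M x)); first by move=> *; apply: carlitz_actD.
  exact: carlitz_actr0.
rewrite -[N in LHS]coefK poly_def actsum.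
transitivity (\sum_(i < size N) \sum_(j < size N)
    iota (theta ((N`_i)%:P * ec i j)) * x ^+ (q ^ j)).
  apply: eq_bigr => i _; rewrite -mul_polyC carlitz_actM carlitz_actC carlitz_actXn.
  rewrite (big_ord_widen (size N) (fun j => iota (theta (ec i j)) * x ^+ (q ^ j))) //.
  rewrite mulr_sumr big_mkcond; apply: eq_bigr => j _.
  case: ltnP => [_|ltij]; first by rewrite !rmorphM mulrA.
  by rewrite carlitz_Xn_coef_gt // mulr0 !rmorph0 mul0r.
rewrite exchange_big; apply: eq_bigr => j _.
by rewrite -mulr_suml -!rmorph_sum.
Qed.

End Action.
End CarlitzCoefficients.

(** * Congruences between integral elements *)

Section Frobenius.

Variables (F : finFieldType) (L : fieldType) (j : {rmorphism {poly F} -> L}).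
Hypothesis j_inj : injective j.
Implicit Types (P a s e : {poly F}) (f h Phi : {poly {poly F}}) (x y b : L).

Local Notation q := #|F|.
Local Notation integral := (integralOver j).
Local Notation ev f x := (map_poly j f).[x].

Lemma integral_ev f x : integral x -> integral (ev f x).
Proof.
move=> intx; apply: integral_horner => //; apply/integral_poly => i.
by rewrite coef_map; apply: integral_id.
Qed.

Lemma integral_expn x n : integral x -> integral (x ^+ n).
Proof.
move=> intx; have := integral_ev 'X^n intx.
by rewrite map_polyXn hornerXn.
Qed.

Lemma irreducible_dvdp_exp P a n : irreducible_poly P -> P %| a ^+ n -> P %| a.
Proof.
move=> irrP; apply: contraLR; rewrite -irreducible_poly_coprime // => cop.
rewrite -irreducible_poly_coprime //; exact: coprimep_expr.
Qed.

(* F[X] is integrally closed. *)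
Lemma dvdp_integral P a b : irreducible_poly P -> integral b -> j a = j P * b -> P %| a.
Proof.
move=> irrP [p monp pb] aE; set m := (size p).-1.
have sp : size p = m.+1 by rewrite prednK // size_poly_gt0 monic_neq0.
pose S := \sum_(i < m) p`_i * a ^+ i * P ^+ (m - i).-1.
(* This is p(b) = 0 multiplied by P^m, with P b replaced by a. *)
have aS : a ^+ m = - (P * S).
  apply: j_inj; apply/eqP; rewrite rmorphN -addr_eq0; apply/eqP.
  transitivity (j P ^+ m * ev p b); last by rewrite (eqP pb) mulr0.
  have sjp : size (map_poly j p) = m.+1.
    by rewrite size_map_poly_id0 // (monicP monp) rmorph1 oner_neq0.
  rewrite horner_coef sjp.
  rewrite big_ord_recr /= coef_map /= [p`_m](monicP monp : lead_coef p = 1) rmorph1 mul1r.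
  rewrite mulrDr -exprMn -aE rmorphXn addrC; congr (_ + _).
  rewrite rmorphM rmorph_sum !mulr_sumr; apply: eq_bigr => i _.
  have ltim := ltn_ord i.
  rewrite coef_map !rmorphM !rmorphXn aE exprMn /=.
  have -> : j P ^+ m = j P * (j P ^+ i * j P ^+ (m - i).-1).
    by rewrite mulrCA -exprS prednK ?subn_gt0 // -exprD subnKC // ltnW.
  by move: (j P ^+ i) (j P ^+ _) => u v; ring.
apply: (@irreducible_dvdp_exp P a m) => //.
by rewrite aS dvdpNr dvdp_mulr.
Qed.

Definition congruent P x y := exists2 b, integral b & x - y = j P * b.

Lemma congruent_refl P x : congruent P x x.
Proof. by exists 0; [exact: integral0 | rewrite subrr mulr0]. Qed.

Lemma congruent_dvdp P a e : P %| a - e -> congruent P (j a) (j e).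
Proof.
by case/dvdpP=> c E; exists (j c); [exact: integral_id | rewrite -rmorphB E mulrC rmorphM].
Qed.

Lemma congruent_sym P x y : congruent P x y -> congruent P y x.
Proof.
by case=> b intb E; exists (- b); [exact: integral_opp | rewrite mulrN -E opprB].
Qed.

Lemma congruent_trans P y x z : congruent P x y -> congruent P y z -> congruent P x z.
Proof.
case=> b intb E [c intc E']; exists (b + c); first exact: integral_add.
by rewrite mulrDr -E -E' addrA subrK.
Qed.

Lemma congruentD P x y x' y' :
  congruent P x y -> congruent P x' y' -> congruent P (x + x') (y + y').
Proof.
case=> b intb E [c intc E']; exists (b + c); first exact: integral_add.
by rewrite mulrDr -E -E' opprD addrACA.
Qed.

Lemma congruentM P x y x' y' : integral x -> integral y' ->
  congruent P x y -> congruent P x' y' -> congruent P (x * x') (y * y').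
Proof.
move=> intx inty' [b intb E] [c intc E']; exists (x * c + b * y').
  by apply: integral_add; apply: integral_mul.
by rewrite mulrDr mulrCA -E' mulrA -E mulrBl mulrBr addrA subrK.
Qed.

Lemma congruent_ev P f x y : integral x -> integral y ->
  congruent P x y -> congruent P (ev f x) (ev f y).
Proof.
move=> intx inty cxy; elim/poly_ind: f => [|f c IH].
  by rewrite rmorph0 !horner0; apply: congruent_refl.
rewrite rmorphD rmorphM /= map_polyX map_polyC !hornerMXaddC.
apply: congruentD; last exact: congruent_refl.
by apply: congruentM => //; apply: integral_ev.
Qed.

(** The power |P| is additive on L, and the coefficients of f lie in F[X], where c^|P| is congruent
    to c modulo P. *)
Lemma congruent_frobenius P f x : monic_irreducible_poly P -> integral x ->
  congruent P (ev f x ^+ (q ^ (size P).-1)) (ev f (x ^+ (q ^ (size P).-1))).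
Proof.
move=> hP intx; set Q := (q ^ _)%N.
have Qnat : [pchar L].-nat Q by rewrite pnatX (q_pnat (j \o @polyC F)).
have Q0 : (0 < Q)%N by rewrite expn_gt0 ltnW // q_gt1.
elim/poly_ind: f => [|f c IH].
  by rewrite rmorph0 !horner0 expr0n gtn_eqF //; apply: congruent_refl.
rewrite rmorphD rmorphM /= map_polyX map_polyC !hornerMXaddC.
rewrite exprDn_pchar // exprMn; apply: congruentD; last first.
  by rewrite -rmorphXn; apply/congruent_dvdp/(dvdp_exp_card hP).
apply: congruentM => //; first exact/integral_expn/integral_ev.
  exact: integral_expn.
exact: congruent_refl.
Qed.

(* Dedekind's argument: if y were not a root of f it would be one of h, and then
   s * Phi'(y) = f(y) h'(y) would be divisible by P. *)
Lemma frobenius_root P f h Phi s e x y b :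
  monic_irreducible_poly P -> f * h = s%:P * Phi -> ~~ (P %| s * e) ->
  integral x -> integral y -> integral b ->
  congruent P y (x ^+ (q ^ (size P).-1)) ->
  ev f x = 0 -> ev Phi y = 0 -> ev Phi^`() y * b = j e -> ev f y = 0.
Proof.
move=> hP fh nPse intx inty intb cyx fx Phiy Phi'y.
have [b0 intb0 fyE] : congruent P (ev f y) 0.
  apply: congruent_trans (congruent_ev f inty (integral_expn _ intx) cyx) _.
  apply: congruent_trans (congruent_sym (congruent_frobenius f hP intx)) _.
  rewrite fx expr0n gtn_eqF; first exact: congruent_refl.
  by rewrite expn_gt0 ltnW // q_gt1.
rewrite subr0 in fyE; apply/eqP; apply: contraNT nPse => fy0.
have := congr1 (fun p => ev p y) fh; rewrite !rmorphM !hornerM Phiy mulr0.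
move/eqP; rewrite mulf_eq0 (negPf fy0) /= => /eqP hy.
(* The factor b turns Phi'(y) into the element e of F[X]: s e = s Phi'(y) b = f(y) h'(y) b = P b0
   h'(y) b. *)
apply: (@dvdp_integral P _ (b0 * ev h^`() y * b)) => //; first exact: hP.1.
  by apply: integral_mul => //; apply: integral_mul => //; apply: integral_ev.
rewrite rmorphM -Phi'y !mulrA -fyE.
have := congr1 (fun p => ev p^`() y) fh.
rewrite !derivM derivC mul0r add0r rmorphD !rmorphM /= hornerD !hornerM.
by rewrite hy mulr0 add0r map_polyC hornerC => ->.
Qed.

End Frobenius.

(** * Denominators, and monic polynomials in residue classes *)

Lemma fractionP (R : idomainType) (x : {fraction R}) :
  exists a b : R, b != 0 /\ x = tofrac a / tofrac b.
Proof.
elim/quotW: x => r; exists (frac r).1, (frac r).2.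
have d0 := denom_ratioP r; split=> //.
apply: (@mulIf _ (tofrac (frac r).2)); first by rewrite tofrac_eq0.
rewrite mulfVK ?tofrac_eq0 //; unlock FracField.tofrac.
rewrite -[LHS]FracField.pi_mul; apply/eqP; rewrite eqmodE /= FracField.equivfE.
by rewrite /FracField.mulf !numden_Ratio ?mulf_neq0 ?oner_neq0 // !mulr1 mulrC.
Qed.

Lemma clear_denominators (R : idomainType) (p : {poly {fraction R}}) :
  exists s (p1 : {poly R}), s != 0 /\ tofrac s *: p = map_poly (@tofrac R) p1.
Proof.
elim/poly_ind: p => [|p x [s [p1 [s0 E]]]].
  by exists 1, 0; rewrite oner_neq0 scaler0 rmorph0.
have [a [b [b0 ->]]] := fractionP x.
exists (s * b), (b *: p1 * 'X + (s * a)%:P); split; first by rewrite mulf_neq0.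
rewrite [RHS]rmorphD [in RHS]rmorphM /= map_polyX map_polyC /= map_polyZ /= -E scalerDr.
congr (_ + _); first by rewrite scalerA -rmorphM mulrC scalerAl.
have -> : tofrac (s * a) = tofrac (s * b) * (tofrac a / tofrac b).
  by rewrite !tofracM -mulrA [X in _ = _ * X]mulrC divfK // tofrac_eq0.
by rewrite -mul_polyC -polyCM.
Qed.

(** Take c congruent to a modulo N and to 1 modulo g, the largest divisor of e prime to N, and add a
    monic multiple of N g of large degree. A common divisor of the sum and e is prime to N, hence
    divides g, to which the sum is coprime. *)
Lemma monic_in_class (F : fieldType) (a N e : {poly F}) (b : bool) :
  coprimep a N -> N != 0 -> e != 0 ->
  exists n, [/\ n \is monic, N %| n - a, coprimep n e & odd (size n).-1 = b].
Proof.
move=> cop_aN N0 e0; pose g := gdcop N e.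
have cop_gN : coprimep g N by apply: coprimep_gdco.
have g0 : g != 0 by apply: contraNneq e0 => g0; move: (dvdp_gdco N e); rewrite -/g g0 dvd0p.
have [c cN cg] : exists2 c, N %| c - a & g %| c - 1.
  have /Bezout_eq1_coprimepP[[u v] /= uv] := cop_gN.
  exists (a * (u * g) + v * N).
    have -> : a * (u * g) + v * N - a = (v - a * v) * N.
      by rewrite -[X in _ - X]mulr1 -uv; ring.
    exact: dvdp_mull.
  have -> : a * (u * g) + v * N - 1 = (a * u - u) * g by rewrite -uv; ring.
  exact: dvdp_mull.
have M0 : N * g != 0 by rewrite mulf_neq0.
(* The first summand makes [u] longer than [c]; the last one is 0 or 1 and gives the degree of u + c
   the parity [b]. *)
pose k := (size c + (odd (size c + (size (N * g)%R).-1) (+) b))%N.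
pose u := (lead_coef (N * g))^-1 *: (N * g) * 'X^k.
have l0 : (lead_coef (N * g))^-1 != 0 by rewrite invr_eq0 lead_coef_eq0.
have su : size u = (size (N * g)%R + k)%N.
  by rewrite size_mulXn ?scaler_eq0 ?negb_or ?l0 // size_scale // addnC.
have sM : (0 < size (N * g)%R)%N by rewrite size_poly_gt0.
have lt_cu : (size c < size u)%N.
  by rewrite su /k addnCA -[X in (X < _)%N]addn0 ltn_add2l addn_gt0 sM.
have Mu : N * g %| u by rewrite /u -scalerAl dvdpZr // dvdp_mulr.
have gn : coprimep (u + c) g.
  have [w E] : exists w, u + c - w * g = 1.
    have /dvdpP[w1 E1] := dvdp_trans (dvdp_mull N (dvdpp g)) Mu.
    have /dvdpP[w2 E2] := cg; exists (w1 + w2).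
    by rewrite E1 -[c](subrK 1) E2; ring.
  by apply/Bezout_eq1_coprimepP; exists (1, - w); rewrite /= mul1r mulNr.
have Na : N %| u + c - a.
  by rewrite -addrA dvdp_add //; apply: dvdp_trans Mu; apply: dvdp_mulr.
exists (u + c); split => //.
- rewrite monicE lead_coefDl // lead_coef_Mmonic ?monicXn // lead_coefZ.
  by rewrite mulVf // lead_coef_eq0.
- have nN : coprimep (u + c) N.
    have /Bezout_eq1_coprimepP[[v w] /= vw] := cop_aN.
    have /dvdpP[z E] := Na.
    apply/Bezout_eq1_coprimepP; exists (v, w - v * z) => /=.
    by rewrite -[u + c](subrK a) E -vw; ring.
  have hmax h : h %| e -> coprimep h N -> h %| g.
    by rewrite /g; case: gdcopP => r _ _; apply.
  apply/coprimepP => h hn he.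
  apply: (coprimepP _ _ gn) => //; apply: hmax => //.
  exact: coprimep_dvdr hn nN.
have sc := size_polyDl lt_cu; rewrite sc su /k.
rewrite -subn1 addnC -addnBA // subn1 !oddD oddb.
by case: (odd (size c)); case: (odd _); case: b {k u l0 su lt_cu Mu gn Na sc}.
Qed.

(** * The Carlitz module modulo a monic prime *)

Section CarlitzModP.

Variables (F : finFieldType) (K L : fieldType).
Variables (theta : {rmorphism {poly F} -> K}) (iota : {rmorphism K -> L}).
Implicit Types N P : {poly F}.

Local Notation q := #|F|.
Local Notation act := (carlitz_act theta 1 iota).
Local Notation j := (iota \o theta).

Lemma carlitz_act_opp N x : act N (- x) = - act N x.
Proof.
by apply/eqP; rewrite -addr_eq0 -carlitz_act_additive addNr carlitz_act0.
Qed.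

Lemma carlitz_act_sign N n x : act N ((-1) ^+ n * x) = (-1) ^+ n * act N x.
Proof.
elim: n => [|n IH]; first by rewrite !expr0 !mul1r.
by rewrite !exprS !mulN1r !mulNr carlitz_act_opp IH.
Qed.

(** The leading coefficient of C_N is a nonzero constant of F; dividing by it gives a monic equation
    over F[X]. *)
Lemma torsion_integral N x : N != 0 -> act N x = 0 -> integralOver j x.
Proof.
move=> N0; rewrite carlitz_actE; set d := (size N).-1.
have -> : size N = d.+1 by rewrite prednK // size_poly_gt0.
rewrite big_ord_recr /= carlitz_coef_lead // => Nx.
pose u : {poly F} := ((lead_coef N)^-1)%:P.
pose p : {poly {poly F}} := \sum_(i < d) (u * carlitz_coef N i) *: 'X^(q ^ i).
have sp : (size p < size ('X^(q ^ d) : {poly {poly F}}))%N.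
  rewrite size_polyXn ltnS (leq_trans (size_sum _ _ _)) //.
  apply/bigmax_leqP => i _; rewrite (leq_trans (size_scale_leq _ _)) //.
  by rewrite size_polyXn ltn_exp2l ?q_gt1.
exists ('X^(q ^ d) + p); first by rewrite monicE lead_coefDl // lead_coefXn.
rewrite rootE rmorphD /= map_polyXn hornerD hornerXn rmorph_sum horner_sum /=.
have ul : u * (lead_coef N)%:P = 1 by rewrite -polyCM mulVf ?lead_coef_eq0.
apply/eqP; transitivity (j u * 0); last by rewrite mulr0.
rewrite -[in RHS]Nx mulrDr addrC mulr_sumr; congr (_ + _).
  apply: eq_bigr => i _.
  by rewrite map_polyZ map_polyXn hornerZ hornerXn !rmorphM /= mulrA.
by rewrite mulrA -[iota _]/(j (lead_coef N)%:P) -rmorphM ul rmorph1 mul1r.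
Qed.

Lemma congruent_carlitz_act P x : monic_irreducible_poly P -> integralOver j x ->
  congruent j P (act P x) (x ^+ (q ^ (size P).-1)).
Proof.
move=> hP intx; rewrite carlitz_actE.
have P0 : P != 0 by rewrite monic_neq0 // hP.2.
have -> : size P = (size P).-1.+1 by rewrite prednK // size_poly_gt0.
rewrite big_ord_recr /= carlitz_coef_lead // (monicP hP.2) !rmorph1 mul1r.
rewrite -[X in congruent _ _ _ X]add0r; apply: congruentD; last exact: congruent_refl.
apply: (big_ind (fun y => congruent j P y 0)); first exact: congruent_refl.
  by move=> y z cy cz; rewrite -[0]addr0; apply: congruentD.
move=> i _; have /dvdpP[c E] := dvdp_carlitz_coef hP.1 hP.2 (ltn_ord i).
exists (j c * x ^+ (q ^ i)).
  by apply: integral_mul; [exact: integral_id | exact: integral_expn].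
by rewrite subr0 E !rmorphM /= mulrA [_ * iota (theta P)]mulrC.
Qed.

End CarlitzModP.

(** * Conjugates of a torsion point together with i *)

Section CarlitzPoly.

Variable F : finFieldType.

Definition carlitz_poly (N : {poly F}) : {poly {poly F}} :=
  \sum_(k < size N) carlitz_coef N k *: 'X^(#|F| ^ k).

Lemma deriv_carlitz_poly N : (carlitz_poly N)^`() = N%:P.
Proof.
rewrite /carlitz_poly raddf_sum /=.
have [->|N0] := eqVneq N 0; first by rewrite size_poly0 big_ord0.
rewrite -(prednK (_ : 0 < size N)%N) ?size_poly_gt0 // big_ord_recl big1 => [|k _].
  by rewrite addr0 derivZ derivXn carlitz_coef0 expn0 /= alg_polyC.
rewrite derivZ derivXn /= expnS -mulr_natr natrM.
by rewrite (natr_q (@polyC {poly F} \o @polyC F)) mul0r mulr0 scaler0.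
Qed.

Lemma carlitz_polyE (K L : fieldType) (theta : {rmorphism {poly F} -> K})
    (iota : {rmorphism K -> L}) N x :
  (map_poly (iota \o theta) (carlitz_poly N)).[x] = carlitz_act theta 1 iota N x.
Proof.
rewrite carlitz_actE rmorph_sum horner_sum; apply: eq_bigr => k _.
by rewrite /= map_polyZ map_polyXn hornerZ hornerXn.
Qed.

End CarlitzPoly.

Section Joint.

Variables (L : fieldType) (iota : {rmorphism {fraction {poly 'F_3}} -> L}) (i : L).
Hypothesis sqr_i : i ^+ 2 = -1.

Local Notation A := {poly 'F_3}.
Local Notation j := (iota \o @tofrac A).
Local Notation act := (carlitz_act (@tofrac A) 1 iota).
Local Notation ev f x := (map_poly j f).[x].
Local Notation deg P := (size (P : A)).-1.

Let j_inj : injective j.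
Proof. by move=> a b /fmorph_inj/tofrac_inj. Qed.

Lemma three_eq0 : 3%:R = 0 :> L.
Proof. by have := natr_q (j \o @polyC 'F_3); rewrite card_Fp. Qed.

Lemma expr_i n : i ^+ (3 ^ n) = (-1) ^+ n * i.
Proof.
elim: n => [|n IH]; first by rewrite mul1r.
rewrite expnSr exprM IH exprMn -exprM mulnC exprM [(-1) ^+ 3]exprS sqrrN expr1n mulr1.
by rewrite exprS sqr_i mulrN1 mulrN exprS mulN1r mulNr.
Qed.

(** This is C_N(T i) / i, an element of F[X] because i^(3^k) = (-1)^k i and only the powers x^(3^k)
    occur in C_N. *)
Definition imag_act (N T : A) : A :=
  \sum_(k < size N) carlitz_coef N k * (T ^+ (3 ^ k) * (-1) ^+ k).

Lemma carlitz_act_imag N T : act N (j T * i) = i * j (imag_act N T).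
Proof.
rewrite carlitz_actE card_Fp // rmorph_sum mulr_sumr; apply: eq_bigr => k _.
rewrite exprMn expr_i !rmorphM !rmorphXn rmorphN1 /=.
by move: (_ ^+ _) ((-1) ^+ _) => u v; ring.
Qed.

(** Otherwise the infinitely many points X^k i would all be roots of C_N. *)
Lemma imag_act_neq0 N : N != 0 -> exists T, imag_act N T != 0.
Proof.
move=> N0; have i0 : i != 0.
  by apply/eqP => i0; move: sqr_i; rewrite i0 expr0n => /esym/eqP; rewrite oppr_eq0 oner_eq0.
pose p := map_poly iota (carlitz (@tofrac A) 1 N).
have p0 : p != 0.
  rewrite -size_poly_gt0 size_map_poly size_carlitz ?oner_neq0 //.
  exact: tofrac_inj.
have us : uniq (mkseq (fun k => j 'X^k * i) (size p)).
  apply: mkseq_uniq => k l /(mulIf i0)/j_inj/(congr1 (fun u : A => size u)).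
  by rewrite !size_polyXn => -[].
have [allp|] := boolP (all (root p) (mkseq (fun k => j 'X^k * i) (size p))).
  by have := max_poly_roots p0 allp us; rewrite size_mkseq ltnn.
case/allPn => _ /mapP[k _ ->]; rewrite rootE.
rewrite -[p.[_]]/(act N (j 'X^k * i)) carlitz_act_imag => m0.
by exists 'X^k; apply: contraNneq m0 => ->; rewrite rmorph0 mulr0.
Qed.

(* If C_N(x) = 0 and m = imag_act N T then C_N(x +- T i) = +- i m, so x +- T i are
   roots of C_N^2 + m^2, whose coefficients no longer involve i. *)
Definition joint_poly N T : {poly A} := carlitz_poly N ^+ 2 + (imag_act N T ^+ 2)%:P.

Lemma joint_polyE N T y : ev (joint_poly N T) y = act N y ^+ 2 + j (imag_act N T) ^+ 2.
Proof.
rewrite rmorphD rmorphXn /= map_polyC hornerD horner_exp hornerC carlitz_polyE.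
congr (_ + _); exact: (rmorphXn j).
Qed.

Lemma deriv_joint_polyE N T y : ev (joint_poly N T)^`() y = 2%:R * act N y * j N.
Proof.
rewrite derivD derivC addr0 expr2 derivM deriv_carlitz_poly rmorphD !rmorphM /=.
by rewrite map_polyC hornerD !hornerM hornerC carlitz_polyE /=; ring.
Qed.

Section Step.

Variables (N T s : A) (f h : {poly A}) (x : L).
Hypotheses (N0 : N != 0) (Nx : act N x = 0).
Hypothesis fh : f * h = s%:P * joint_poly N T.

Let good b n := ev f (act b x + (-1) ^+ n * (j T * i)) = 0.

(** The old point raised to the power |P| is congruent modulo P to the new one: z^|P| to C_P(z) for
    integral z, T^|P| to T, and i^|P| = (-1)^(deg P) i. *)
Lemma root_joint_frobenius P b n : monic_irreducible_poly P ->
    ~~ (P %| s * (imag_act N T * N)) ->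
  good b n -> good (P * b) (deg P + n).
Proof.
move=> hP nP gb.
have int_i : integralOver j i.
  exists ('X^2 + 1%:P); first exact: monicXnaddC.
  by rewrite rootE rmorphD /= map_polyXn map_polyC /= !rmorph1 !hornerE sqr_i addNr.
have int_sign k : integralOver j ((-1) ^+ k).
  by apply: integral_expn; apply: integral_opp; apply: integral1.
have int_ti k : integralOver j ((-1) ^+ k * (j T * i)).
  by apply: integral_mul => //; apply: integral_mul => //; apply: integral_id.
have Nbx c : act N (act c x) = 0 by rewrite -carlitz_actM mulrC carlitz_actM Nx carlitz_act0.
have int_bx c : integralOver j (act c x) := torsion_integral N0 (Nbx c).
have int_th c k : integralOver j (act c x + (-1) ^+ k * (j T * i)) by apply: integral_add.
have Nth c k : act N (act c x + (-1) ^+ k * (j T * i)) = (-1) ^+ k * (i * j (imag_act N T)).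
  by rewrite carlitz_act_additive Nbx add0r carlitz_act_sign carlitz_act_imag.
have sgn2 k : (-1) ^+ k * (-1) ^+ k = 1 :> L by rewrite -expr2 -exprM mulnC exprM sqrrN !expr1n.
(* With e the sign and m = [imag_act N T], the choice b = e i gives Phi'(y) b = 2 (e i m N) (e i) =
   -2 m N, which is m N in characteristic 3. *)
apply: (frobenius_root (j := j) j_inj hP fh nP (int_th b n) (int_th _ _)
          (b := (-1) ^+ (deg P + n) * i) _ _ gb).
- exact: integral_mul.
- have Qnat : [pchar L].-nat (#|'F_3| ^ deg P)%N by rewrite pnatX (q_pnat (j \o @polyC 'F_3)).
  rewrite exprDn_pchar // carlitz_actM; apply: congruentD.
    exact: congruent_carlitz_act.
  have -> : ((-1) ^+ n * (j T * i)) ^+ (#|'F_3| ^ deg P) =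
      (-1) ^+ (deg P + n) * i * j (T ^+ (#|'F_3| ^ deg P)).
    rewrite !exprMn card_Fp // expr_i -rmorphXn -exprM mulnC exprM.
    have -> : (-1) ^+ (3 ^ deg P) = -1 :> L.
      elim: (deg P) => [|k IH]; first by rewrite expr1.
      by rewrite expnSr exprM IH exprS sqrrN expr1n mulr1.
    by rewrite exprD; ring.
  have -> : (-1) ^+ (deg P + n) * (j T * i) = (-1) ^+ (deg P + n) * i * j T by ring.
  apply: congruentM.
  - by apply: integral_mul.
  - exact: integral_id.
  - exact: congruent_refl.
  - by apply/congruent_sym/congruent_dvdp/(dvdp_exp_card hP).
- rewrite joint_polyE Nth; move: (sgn2 (deg P + n)) sqr_i.
  move: (j (imag_act N T)) ((-1) ^+ (deg P + n)) => m e e2 i2.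
  by rewrite exprMn expr2 e2 exprMn i2; ring.
- rewrite deriv_joint_polyE Nth /= !rmorphM /=; move: (sgn2 (deg P + n)) sqr_i three_eq0.
  move: (iota (tofrac _)) ((-1) ^+ (deg P + n)) (iota (tofrac _)) => u e m e2 i2 t0.
  have -> : 2%:R * (e * (i * m)) * u * (e * i) = 2%:R * (e * e) * i ^+ 2 * (m * u) by ring.
  rewrite e2 i2 mulr1 mulrN1 [m * u]mulrC -[RHS]mul1r; congr (_ * _).
  by apply/eqP; rewrite eq_sym -subr_eq0 opprK -(natrD _ 1 2) t0.
Qed.

End Step.
End Joint.

Lemma horner_substitute (K L : fieldType) (f : {rmorphism K -> L})
    (p0 p1 w v : {poly K}) y b e :
  (map_poly f w).[y] = e -> (map_poly f v).[y] = b ->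
  (map_poly f (p0 \Po v + w * (p1 \Po v))).[y] =
    (map_poly f p0).[b] + e * (map_poly f p1).[b].
Proof.
move=> wE vE.
by rewrite rmorphD rmorphM /= !map_comp_poly hornerD hornerM !horner_comp wE vE.
Qed.

Section Joint.

Variables (L : fieldType) (iota : {rmorphism {fraction {poly 'F_3}} -> L}) (i : L).
Hypothesis sqr_i : i ^+ 2 = -1.

Local Notation A := {poly 'F_3}.
Local Notation K := {fraction A}.
Local Notation j := (iota \o @tofrac A).
Local Notation act := (carlitz_act (@tofrac A) 1 iota).
Local Notation ev f x := (map_poly j f).[x].
Local Notation evK f x := (map_poly iota f).[x].
Local Notation deg P := (size (P : A)).-1.

(** Splits n into monic primes and applies [root_joint_frobenius] to each; the degrees, hence the
    signs, add up. *)
Lemma root_joint_monic (N T s : A) (f h : {poly A}) (x : L) n b k :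
  N != 0 -> act N x = 0 -> f * h = s%:P * joint_poly N T ->
  n \is monic -> coprimep n (s * (imag_act N T * N)) ->
  ev f (act b x + (-1) ^+ k * (j T * i)) = 0 ->
  ev f (act (n * b) x + (-1) ^+ (deg n + k) * (j T * i)) = 0.
Proof.
move=> N0 Nx fh; have [e] := ubnP (size n); elim: e n => // e IH n /ltnSE-len mon_n cop_n fb.
have [sn|sn] := leqP (size n) 1.
  have n1 : n = 1.
    by move: mon_n; rewrite [n](size1_polyC sn) monicE lead_coefC => /eqP->.
  by rewrite n1 size_poly1 mul1r.
have [P0 irrP0 P0n] := irreducible_divisor sn.
have l0 : (lead_coef P0)^-1 != 0 by rewrite invr_eq0 lead_coef_eq0 irredp_neq0.
pose P := (lead_coef P0)^-1 *: P0.
have hP : monic_irreducible_poly P.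
  split; last by rewrite monicE lead_coefZ mulVf // -invr_eq0.
  split=> [|D sD]; first by rewrite size_scale //; case: irrP0.
  rewrite dvdpZr // => /(irrP0.2 _ sD) /eqp_trans; apply.
  by rewrite eqp_sym eqp_scale.
have /dvdpP[n' nE] : P %| n by rewrite dvdpZl.
have mon_n' : n' \is monic by rewrite -(monicMr _ hP.2) -nE.
have sP : (1 < size P)%N := hP.1.1.
have deg_n : deg n = (deg P + deg n')%N.
  have := monic_neq0 mon_n'; have := monic_neq0 hP.2.
  rewrite nE -!size_poly_gt0 => sP0 sn'; rewrite size_Mmonic -?size_poly_gt0 ?hP.2 //.
  by case: (size P) (size n') sP0 sn' => [|u] [|v] //= _ _; rewrite addnS /= addnC.
have lt_n' : (size n' < size n)%N.
  have := monic_neq0 mon_n'; have := monic_neq0 mon_n; rewrite -!size_poly_gt0.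
  move: deg_n sP; case: (size n) (size n') (size P) => [|u] [|v] [|[|w]] //= -> _ _ _.
  by rewrite addSn ltnS ltnS leq_addl.
rewrite nE coprimepMl in cop_n; have /andP[cop_n' cop_P] := cop_n.
have := IH n' (leq_trans lt_n' len) mon_n' cop_n' fb.
rewrite deg_n nE [n' * P]mulrC -mulrA -addnA; apply: (root_joint_frobenius sqr_i N0 Nx fh hP) => //.
by rewrite -(irreducible_poly_coprime _ hP.1).
Qed.

(** The class of a modulo N contains a monic n, prime to the excluded primes and of degree with the
    parity of k, to which [root_joint_monic] applies. *)
Lemma conjugate_joint (N T a : A) (k : nat) (p : {poly K}) (x : L) :
  N != 0 -> imag_act N T != 0 -> act N x = 0 -> coprimep a N ->
  evK p (x + j T * i) = 0 -> evK p (act a x + (-1) ^+ k * (j T * i)) = 0.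
Proof.
move=> N0 m0 Nx cop_aN px; set y := act a x + _.
pose Phi : {poly K} := map_poly (@tofrac A) (joint_poly N T).
have PhiE z : evK Phi z = ev (joint_poly N T) z by rewrite -map_poly_comp.
(* Dedekind's argument requires a divisor of Phi; clearing denominators in g and its cofactor
   introduces the constant s1 s2. *)
pose g := gcdp p Phi.
have /dvdpP[r pE] : g %| p by apply: dvdp_gcdl.
have /dvdpP[h PhigE] : g %| Phi by apply: dvdp_gcdr.
have [s1 [g1 [s10 g1E]]] := clear_denominators g.
have [s2 [h1 [s20 h1E]]] := clear_denominators h.
have fh : g1 * h1 = (s1 * s2)%:P * joint_poly N T.
  have : injective (map_poly (@tofrac A)) by apply: map_inj_poly (@tofrac_inj _) (rmorph0 _).
  apply; rewrite !rmorphM /= -g1E -h1E -/Phi PhigE !map_polyC /= -mulrA !mul_polyC.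
  by rewrite -scalerAl -scalerAr [h * g]mulrC.
have evg1 z : ev g1 z = j s1 * evK g z.
  by rewrite map_poly_comp -g1E map_polyZ hornerZ.
have [n [mon_n nN cop_n odd_n]] :
    exists n, [/\ n \is monic, N %| n - a, coprimep n (s1 * s2 * (imag_act N T * N))
                & odd (deg n) = odd k].
  by apply: monic_in_class => //; rewrite !mulf_neq0.
have gx : evK g (x + j T * i) = 0.
  have Phix : evK Phi (x + j T * i) = 0.
    rewrite PhiE joint_polyE carlitz_act_additive Nx add0r carlitz_act_imag //.
    by rewrite exprMn sqr_i mulN1r addNr.
  apply/eqP; rewrite -[_ == 0]/(root _ _) /g gcdp_map root_gcd.
  by rewrite !rootE px Phix eqxx.
have := root_joint_monic (x := x) (b := 1) (k := 0) N0 Nx fh mon_n cop_n.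
rewrite carlitz_act1 expr0 mul1r mulr1 addn0 evg1 gx mulr0 => /(_ erefl).
have -> : act n x = act a x.
  have /dvdpP[c E] := nN; apply/eqP; rewrite -subr_eq0 -carlitz_actB E carlitz_actM Nx.
  by rewrite carlitz_act0.
rewrite -signr_odd odd_n signr_odd -/y evg1 => /eqP.
rewrite mulf_eq0 fmorph_eq0 tofrac_eq0 (negPf s10) /= => /eqP gy.
by rewrite pE rmorphM hornerM gy mulr0.
Qed.

(* With theta = x + T i, both i = C_N(theta) / imag_act N T and x = theta - T i
   are polynomials in theta. *)
Lemma conjugate_torsion (N a : A) (k : nat) (p0 p1 : {poly K}) (x : L) :
  N != 0 -> act N x = 0 -> coprimep a N ->
  evK p0 x + i * evK p1 x = 0 ->
  evK p0 (act a x) + (-1) ^+ k * i * evK p1 (act a x) = 0.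
Proof.
move=> N0 Nx cop_aN; have [T m0] := imag_act_neq0 iota sqr_i N0.
pose w : {poly K} := (tofrac (imag_act N T))^-1 *: carlitz (@tofrac A) 1 N.
pose v : {poly K} := 'X - tofrac T *: w.
pose p := p0 \Po v + w * (p1 \Po v).
have pE b n : act N b = 0 -> evK p (b + (-1) ^+ n * (j T * i)) =
    evK p0 b + (-1) ^+ n * i * evK p1 b.
  move=> Nb; set y := b + _.
  have wE : evK w y = (-1) ^+ n * i.
    rewrite map_polyZ hornerZ -[(map_poly _ _).[y]]/(act N y).
    rewrite carlitz_act_additive Nb add0r carlitz_act_sign carlitz_act_imag //.
    by rewrite fmorphV /=; field; rewrite fmorph_eq0 tofrac_eq0.
  have vE : evK v y = b.
    by rewrite rmorphB /= map_polyX map_polyZ hornerD hornerN hornerX hornerZ wE /y /=; ring.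
  exact: horner_substitute.
move=> px; rewrite -pE; last by rewrite -carlitz_actM mulrC carlitz_actM Nx carlitz_act0.
by apply: (conjugate_joint k N0 m0 Nx cop_aN); have := pE x 0 Nx; rewrite expr0 !mul1r px.
Qed.

End Joint.

(** * Extension of partial automorphisms *)

Lemma separable_neq0 (F : fieldType) (p : {poly F}) : separable_poly p -> p != 0.
Proof.
by apply: contraTneq => ->; rewrite unlock deriv0 coprimep0 -size_poly_eq1 size_poly0.
Qed.

Section PartialHom.

Variables (K L : fieldType) (iota : {rmorphism K -> L}).
Implicit Types (G : set (L * L)) (p : {poly L * L}).

(* A ring homomorphism over K from a subring of L to L, given by its graph. *)
Record partial_hom G : Prop := PartialHom {
  partial_hom_diag : forall k, G (iota k, iota k);
  partial_homB : forall x y, G x -> G y -> G (x - y);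
  partial_homM : forall x y, G x -> G y -> G (x * y);
  partial_hom_fun : forall y, G (0, y) -> y = 0 }.

(** The two projections of such a p are a polynomial over the domain of G and its image under the
    homomorphism. *)
Definition coefs_in G p := forall i, G p`_i.

Let diag (k : K) : L * L := (iota k, iota k).

Section Closure.

Variable (G : set (L * L)).
Hypothesis hG : partial_hom G.

Lemma partial_hom0 : G 0.
Proof. by have := partial_hom_diag hG 0; rewrite rmorph0. Qed.

Lemma partial_hom1 : G 1.
Proof. by have := partial_hom_diag hG 1; rewrite rmorph1. Qed.

Lemma partial_homN x : G x -> G (- x).
Proof. by move=> Gx; rewrite -sub0r; apply: (partial_homB hG) => //; apply: partial_hom0. Qed.

Lemma partial_homD x y : G x -> G y -> G (x + y).
Proof.
by move=> Gx Gy; rewrite -[y]opprK; apply: (partial_homB hG) => //; apply: partial_homN.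
Qed.

Lemma partial_hom_eq x y : G x -> G y -> x.1 = y.1 -> x = y.
Proof.
case: x y => [x1 x2] [y1 y2] Gx Gy /= eq1; subst y1.
have := partial_homB hG Gx Gy; rewrite -[_ - _]/(x1 - x1, x2 - y2) subrr.
by move/(partial_hom_fun hG)/eqP; rewrite subr_eq0 => /eqP->.
Qed.

Lemma partial_hom_sum (I : Type) (r : seq I) (F : I -> L * L) :
  (forall i, G (F i)) -> G (\sum_(i <- r) F i).
Proof. by move=> GF; apply: big_ind => //; [apply: partial_hom0 | apply: partial_homD]. Qed.

Lemma coefs_inC x : G x -> coefs_in G x%:P.
Proof. by move=> Gx i; rewrite coefC; case: eqP => _ //; apply: partial_hom0. Qed.

Lemma coefs_inX : coefs_in G 'X.
Proof.
by move=> i; rewrite coefX; case: eqP => _; [apply: partial_hom1 | apply: partial_hom0].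
Qed.

Lemma coefs_inB p r : coefs_in G p -> coefs_in G r -> coefs_in G (p - r).
Proof. by move=> Gp Gr i; rewrite coefB; apply: (partial_homB hG). Qed.

Lemma coefs_inM p r : coefs_in G p -> coefs_in G r -> coefs_in G (p * r).
Proof.
by move=> Gp Gr i; rewrite coefM; apply: partial_hom_sum => j; apply: (partial_homM hG).
Qed.

Lemma coefs_in_diag (p : {poly K}) : coefs_in G (map_poly diag p).
Proof.
by move=> i; rewrite coef_map_id0 ?/diag ?rmorph0 //; apply: (partial_hom_diag hG).
Qed.

Lemma coefs_in_horner p x : coefs_in G p -> G x -> G p.[x].
Proof.
move=> Gp Gx; rewrite horner_coef; apply: partial_hom_sum => i.
apply: (partial_homM hG) => //; elim: (nat_of_ord i) => [|n IH].
  exact: partial_hom1.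
by rewrite exprS; apply: (partial_homM hG).
Qed.

End Closure.

Let map_fst_diag (p : {poly K}) : map_poly fst (map_poly diag p) = map_poly iota p.
Proof. by apply/polyP=> i; rewrite coef_map !coef_map_id0 ?/diag ?rmorph0. Qed.

Let map_snd_diag (p : {poly K}) : map_poly snd (map_poly diag p) = map_poly iota p.
Proof. by apply/polyP=> i; rewrite coef_map !coef_map_id0 ?/diag ?rmorph0. Qed.

Let horner_fst p x : (p.[x]).1 = (map_poly fst p).[x.1].
Proof. by rewrite horner_map. Qed.

Let horner_snd p x : (p.[x]).2 = (map_poly snd p).[x.2].
Proof. by rewrite horner_map. Qed.

Hypothesis hL : separable_closure iota.

(** After cancelling powers of X, algebraicity gives p(x) x + c = 0 with c nonzero, so the inverse
    -p(x) / c is a polynomial in x over K. *)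
Lemma partial_hom_inv G x : partial_hom G -> G x -> x.1 != 0 ->
  exists2 y, G y & x * y = 1.
Proof.
move=> hG Gx x0; have [p /separable_neq0] := hL.1 x.1.
elim/poly_ind: p => [|p c IH]; first by rewrite eqxx.
have [->|c0] := eqVneq c 0.
  rewrite addr0 mulf_eq0 negb_or => /andP[p0 _].
  rewrite rootE rmorphM /= map_polyX hornerMX mulf_eq0 (negPf x0) orbF.
  exact: IH.
move=> _; rewrite rootE rmorphD rmorphM /= map_polyX map_polyC hornerMXaddC.
move=> /eqP pc0; have Gy : G (- diag c^-1 * (map_poly diag p).[x]).
  apply: (partial_homM hG).
    by apply: (partial_homN hG); apply: (partial_hom_diag hG).
  by apply: (coefs_in_horner hG) => //; apply: (coefs_in_diag hG).
exists (- diag c^-1 * (map_poly diag p).[x]) => //.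
apply: (partial_hom_eq hG); [exact: (partial_homM hG)|exact: partial_hom1|].
rewrite /= horner_fst map_fst_diag mulrCA [x.1 * _]mulrC.
have -> : (map_poly iota p).[x.1] * x.1 = - iota c by apply/eqP; rewrite -addr_eq0 pc0.
by rewrite mulrNN -rmorphM mulVf // rmorph1.
Qed.

(* The minimal polynomial of z over the field on which G is defined. *)
Lemma partial_hom_minpoly G z : partial_hom G ->
  exists m : {poly L * L},
    [/\ m \is monic, coefs_in G m, (map_poly fst m).[z] = 0 &
      forall p, coefs_in G p -> (map_poly fst p).[z] = 0 -> exists r, p = m * r].
Proof.
move=> hG.
pose Q n := exists2 p, coefs_in G p & [/\ p != 0, (map_poly fst p).[z] = 0 & size p = n].
have [n []] : exists n, Q n /\ forall k, Q k -> (n <= k)%N.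
  have [P sepP rootP] := hL.1 z.
  have Q0 : Q (size (map_poly diag P)).
    exists (map_poly diag P); first exact: coefs_in_diag.
    split=> //; last by rewrite map_fst_diag; apply/eqP.
    apply: contraTneq sepP => E; rewrite -(separable_map iota) -map_fst_diag E.
    by rewrite rmorph0; apply/negP => /separable_neq0/eqP.
  apply: NNPP => H; move: (size _) Q0; elim/ltn_ind => n IH Qn.
  case: H; exists n; split=> // k Qk; rewrite leqNgt; apply/negP => ltkn.
  exact: IH ltkn Qk.
move=> [p Gp [p0 pz pn]] minp.
(* An element of G with first component 0 is 0, so a nonzero leading coefficient is invertible
   although [L * L] has zero divisors. *)
have l0 : (lead_coef p).1 != 0.
  apply: contraNneq p0; rewrite -lead_coef_eq0 => l1.
  by apply/eqP/(partial_hom_eq hG); [apply: Gp | apply: partial_hom0 |].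
have [v Gv lv] := partial_hom_inv hG (Gp _ : G (lead_coef p)) l0.
have Gm : coefs_in G (p * v%:P) by apply: coefs_inM => //; apply: coefs_inC.
have mP : p * v%:P \is monic.
  rewrite mulrC mul_polyC monicE lead_coefE; apply/eqP.
  have -> : size (v *: p) = size p.
    apply/eqP; rewrite eqn_leq size_scale_leq leqNgt; apply/negP => sv.
    have : (v *: p)`_(size p).-1 = 0.
      by apply: nth_default; case: (size p) sv.
    by rewrite coefZ mulrC lv => /eqP; rewrite oner_eq0.
  by rewrite coefZ mulrC.
have sm : size (p * v%:P) = size p.
  apply/eqP; rewrite eqn_leq mulrC mul_polyC size_scale_leq /=.
  rewrite pn; apply: minp; exists (v *: p); first by rewrite -mul_polyC mulrC.
  split=> //; first by rewrite -mul_polyC mulrC monic_neq0.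
  by rewrite map_polyZ hornerZ pz mulr0.
have mz : (map_poly fst (p * v%:P)).[z] = 0 by rewrite rmorphM hornerM pz mul0r.
exists (p * v%:P); split=> //.
move: (p * v%:P) mP Gm sm mz => m mP Gm sm mz g.
(* Division by m: minimality of its size rules out a nonzero remainder shorter than m. *)
have [k] := ubnP (size g); elim: k g => // k IH g /ltnSE-legk Gg gz.
have [g0|g0] := eqVneq g 0; first by exists 0; rewrite g0 mulr0.
have lemg : (size m <= size g)%N.
  by rewrite sm pn; apply: minp; exists g.
pose d := lead_coef g *: 'X^(size g - size m).
have Gd : coefs_in G (m * d).
  apply: coefs_inM => // i; rewrite coefZ coefXn; apply: (partial_homM hG); first exact: Gg.
  by case: (i == _); [apply: (partial_hom1 hG) | apply: (partial_hom0 hG)].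
have [|||r gE] := IH (g - m * d).
- rewrite (leq_trans _ legk) //; have sg : (0 < size g)%N by rewrite size_poly_gt0.
  have sm0 : (0 < size m)%N by rewrite size_poly_gt0 monic_neq0.
  have -> : size g = (size g).-1.+1 by rewrite prednK.
  rewrite ltnS; apply/leq_sizeP => j; rewrite leq_eqVlt => /predU1P[<-|ltj].
    rewrite coefB /d -scalerAr coefZ coefMXn ifF; last first.
      by apply/negbTE; rewrite -leqNgt -ltnS prednK // ltn_subrL sm0 sg.
    have -> : ((size g).-1 - (size g - size m) = (size m).-1)%N.
      by rewrite -subn1 subnAC subKn // subn1.
    by rewrite -!lead_coefE (monicP mP) mulr1 subrr.
  apply: nth_default; rewrite prednK // in ltj; apply: leq_trans ltj.
  rewrite (leq_trans (size_polyD _ _)) // size_polyN geq_max leqnn /=.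
  rewrite /d -scalerAr (leq_trans (size_scale_leq _ _)) //.
  by rewrite size_mulXn ?monic_neq0 // subnK.
- exact: coefs_inB.
- by rewrite rmorphB rmorphM /= !hornerE gz mz mul0r subrr.
by exists (r + d); rewrite mulrDr -gE subrK.
Qed.


(** The image w of z is a root of the transported minimal polynomial m, which is separable as m
    divides a separable polynomial over K. The graph of p(z) |-> p(w) is single-valued because p(z)
    = 0 makes p a multiple of m. *)
Lemma partial_hom_adjoin G z : partial_hom G ->
  exists G', [/\ partial_hom G', (G `<=` G')%classic & exists w, G' (z, w)].
Proof.
move=> hG; have [m [mP Gm mz mdiv]] := partial_hom_minpoly z hG.
have [w mw] : exists w, root (map_poly snd m) w.
  have [P sepP rootP] := hL.1 z.
  have [r Pr] : exists r, map_poly diag P = m * r.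
    by apply: mdiv; [exact: coefs_in_diag | rewrite map_fst_diag; apply/eqP].
  apply: hL.2.
    apply: (@dvdp_separable _ (map_poly iota P)); last by rewrite separable_map.
    by rewrite -map_snd_diag Pr rmorphM dvdp_mulr.
  have size_map (f : {rmorphism L * L -> L}) : size (map_poly f m) = size m.
    by rewrite size_map_poly_id0 // (monicP mP) rmorph1 oner_neq0.
  rewrite size_map -(size_map fst) ltnNge; apply/negP => /size1_polyC E.
  have mP1 : map_poly fst m \is monic by apply: monic_map.
  move: mz; rewrite E hornerC => c0; move: mP1.
  by rewrite E c0 monicE lead_coef0 eq_sym oner_eq0.
exists [set v | exists2 p, coefs_in G p & v = p.[(z, w)]]%classic; split.
- split=> [k|_ _ [p Gp ->] [r Gr ->]|_ _ [p Gp ->] [r Gr ->]|y [p Gp]].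
  + by exists (diag k)%:P; [apply/(coefs_inC hG)/(partial_hom_diag hG) | rewrite hornerC].
  + by exists (p - r); [apply: coefs_inB | rewrite !hornerE].
  + by exists (p * r); [apply: coefs_inM | rewrite hornerM].
  + move=> E; have /esym := congr1 fst E; rewrite horner_fst => /= pz.
    have [r pE] := mdiv p Gp pz; have := congr1 snd E.
    by rewrite horner_snd pE rmorphM hornerM /= (eqP mw) mul0r.
- by move=> v Gv; exists v%:P; [apply: (coefs_inC hG) | rewrite hornerC].
- by exists w, 'X; [apply: (coefs_inX hG) | rewrite hornerX].
Qed.

(** The iterates of y are roots of one polynomial over K, so two of them coincide; cancelling by
    injectivity exhibits y as a value of f. *)
Lemma endo_over_bijective (f : {rmorphism L -> L}) :
  (forall k, f (iota k) = iota k) -> bijective f.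
Proof.
move=> fK; have finj : injective f := fmorph_inj f.
have surj y : exists x, f x = y.
  have [p sep_p py] := hL.1 y.
  have rootf n : root (map_poly iota p) (iter n f y).
    elim: n => //= n IH; rewrite rootE.
    have -> : map_poly iota p = map_poly f (map_poly iota p).
      by rewrite -map_poly_comp; apply: eq_map_poly => k /=; rewrite fK.
    by rewrite horner_map (eqP IH) rmorph0.
  have p0 : map_poly iota p != 0 by rewrite map_poly_eq0 separable_neq0.
  have [|] := boolP (looping f y (size (map_poly iota p))).
    move=> /loopingP/(_ (size (map_poly iota p)))/trajectP[k ltk E].
    exists (iter (size (map_poly iota p) - k).-1 f y); rewrite -iterS prednK ?subn_gt0 //.
    have injk n : injective (iter n f) by elim: n => //= n IH x x' /finj/IH.
    by apply: (injk k); rewrite -iterD subnKC // ltnW.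
  rewrite -looping_uniq => un.
  have := max_poly_roots p0 _ un; rewrite size_traject ltnNge leqnSn => H.
  suff: false by []; apply: H; apply/allP => _ /trajectP[k _ ->]; exact: rootf.
pose g y := proj1_sig (constructive_indefinite_description _ (surj y)).
have fg : cancel g f by move=> y; rewrite /g; case: constructive_indefinite_description.
by exists g => // x; apply: finj; rewrite fg.
Qed.

(** A maximal extension of G has domain L by [partial_hom_adjoin], and is then bijective by
    [endo_over_bijective]. *)
Lemma partial_hom_extend G : partial_hom G ->
  exists sigma : galois_group iota, forall x y, G (x, y) -> sigma x = y.
Proof.
move=> hG.
(* Imposing the condition on the union with G makes it hold for the empty set, the union of the
   empty chain. *)
have [|H [PH maxH]] := @classical_sets.Zorn_bigcup _ [set H | partial_hom (H `|` G)]%classic.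
  move=> F FP totF; pose U := (\bigcup_(X in F) X `|` G)%classic.
  have dir x y : U x -> U y -> exists X, [/\ partial_hom X, X x, X y & (X `<=` U)%classic].
    have sub X : F X -> (X `|` G `<=` U)%classic.
      by move=> FX v [Xv|Gv]; [left; exists X | right].
    move=> [[X FX Xx]|Gx] [[Y FY Yy]|Gy].
    - have [XY|YX] := totF _ _ FX FY.
        by exists (Y `|` G)%classic; split; [exact: FP | left; exact: XY | left | exact: sub].
      by exists (X `|` G)%classic; split; [exact: FP | left | left; exact: YX | exact: sub].
    - by exists (X `|` G)%classic; split; [exact: FP | left | right | exact: sub].
    - by exists (Y `|` G)%classic; split; [exact: FP | right | left | exact: sub].
    - by exists G; split=> // v Gv; right.
  split.
  - by move=> k; right; apply: (partial_hom_diag hG).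
  - move=> x y Ux Uy; have [X [hX Xx Xy]] := dir x y Ux Uy; apply.
    exact: (partial_homB hX).
  - move=> x y Ux Uy; have [X [hX Xx Xy]] := dir x y Ux Uy; apply.
    exact: (partial_homM hX).
  - move=> y Uy; have [X [hX Xy _ _]] := dir _ _ Uy Uy.
    exact: (partial_hom_fun hX).
have {}PH : partial_hom (H `|` G)%classic by [].
have tot x : exists y, (H `|` G)%classic (x, y).
  have [G' [hG' HG' [w G'w]]] := partial_hom_adjoin x PH.
  exists w; apply: NNPP => nHw; apply: (maxH G').
    split; last by move=> G'H; apply: nHw; left; apply: G'H.
    by move=> v Hv; apply: HG'; left.
  rewrite /= (_ : (G' `|` G)%classic = G') //; apply: classical_sets.setUidl.
  by move=> v Gv; apply: HG'; right.
pose f x := proj1_sig (constructive_indefinite_description _ (tot x)).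
have fE x y : (H `|` G)%classic (x, y) -> f x = y.
  rewrite /f; case: constructive_indefinite_description => w /= Hw Hy.
  by have [] := partial_hom_eq PH Hw Hy erefl.
have fP x : (H `|` G)%classic (x, f x).
  by rewrite /f; case: constructive_indefinite_description.
have fB : zmod_morphism f by move=> x y; apply: fE; apply: (partial_homB PH (fP x) (fP y)).
have fM : monoid_morphism f.
  split; first by apply: fE; apply: (partial_hom1 PH).
  by move=> x y; apply: fE; apply: (partial_homM PH (fP x) (fP y)).
pose f' : {rmorphism L -> L} := HB.pack f (GRing.isZmodMorphism.Build L L f fB)
  (GRing.isMonoidMorphism.Build L L f fM).
have fK k : f' (iota k) = iota k by apply: fE; apply: (partial_hom_diag PH).
exists (Galois (endo_over_bijective fK) fK) => x y Gxy.
by apply: fE; right.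
Qed.

End PartialHom.

(** * Automorphisms with prescribed action on the torsion *)

Definition mk_modulus (F : finFieldType) (N : {poly F}) (sN : (1 < size N)%N) :
  modulus F := exist _ N sN.

Lemma modulus_mul (F : finFieldType) (M N : modulus F) :
  exists D : modulus F, val D = val M * val N.
Proof.
have sMN : (1 < size (val M * val N)%R)%N.
  case: M N => [M sM] [N sN] /=.
  have M0 : M != 0 by rewrite -size_poly_gt0 ltnW.
  have N0 : N != 0 by rewrite -size_poly_gt0 ltnW.
  by rewrite size_mul //; case: (size M) (size N) sM sN => [|[|u]] [|[|v]] //; rewrite addnS.
by exists (mk_modulus sMN).
Qed.

Section HornerPair.

Variables (K : fieldType) (R : comNzRingType) (f : {rmorphism K -> R}) (d e x y : R).

(* The values at (x, d) and at (y, e) of the polynomial p0(X) + Y p1(X). *)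
Definition horner_pair (p0 p1 : {poly K}) : R * R :=
  ((map_poly f p0).[x] + d * (map_poly f p1).[x],
   (map_poly f p0).[y] + e * (map_poly f p1).[y]).

Lemma horner_pairC c : horner_pair c%:P 0 = (f c, f c).
Proof. by rewrite /horner_pair rmorph0 !horner0 !mulr0 !addr0 map_polyC !hornerC. Qed.

Lemma horner_pairX : horner_pair 'X 0 = (x, y).
Proof. by rewrite /horner_pair rmorph0 map_polyX !horner0 !hornerX !mulr0 !addr0. Qed.

Lemma horner_pairY : horner_pair 0 1 = (d, e).
Proof. by rewrite /horner_pair rmorph0 rmorph1 !horner0 !hornerC !mulr1 !add0r. Qed.

Lemma horner_pairB p0 p1 r0 r1 :
  horner_pair p0 p1 - horner_pair r0 r1 = horner_pair (p0 - r0) (p1 - r1).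
Proof.
by rewrite /horner_pair !rmorphB /= !hornerD !hornerN; congr (_, _) => /=; ring.
Qed.

Lemma horner_pairM p0 p1 r0 r1 : d ^+ 2 = -1 -> e ^+ 2 = -1 ->
  horner_pair p0 p1 * horner_pair r0 r1 =
  horner_pair (p0 * r0 - p1 * r1) (p0 * r1 + p1 * r0).
Proof.
have mulE (h u0 u1 v0 v1 : R) : h ^+ 2 = -1 ->
    (u0 + h * u1) * (v0 + h * v1) = (u0 * v0 - u1 * v1) + h * (u0 * v1 + u1 * v0).
  move=> h2; transitivity (u0 * v0 + h ^+ 2 * (u1 * v1) + h * (u0 * v1 + u1 * v0)).
    by ring.
  by rewrite h2 mulN1r.
move=> d2 e2; rewrite /horner_pair !rmorphB !rmorphD !rmorphM /= !hornerD !hornerN !hornerM.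
by congr (_, _); apply: mulE.
Qed.

End HornerPair.

Section Twist.

Variables (F : finFieldType) (K : fieldType) (theta : {rmorphism {poly F} -> K}).
Variables (R : comNzRingType) (iota : {rmorphism K -> R}).

Lemma horner_pair_act d e x y c N p0 p1 :
  horner_pair iota d e (carlitz_act theta c iota N x) (carlitz_act theta c iota N y) p0 p1 =
  horner_pair iota d e x y (p0 \Po carlitz theta c N) (p1 \Po carlitz theta c N).
Proof. by rewrite /horner_pair !map_comp_poly !horner_comp. Qed.

(** The hypothesis on u makes multiplication by u carry the action of X under rho^c to that under C;
    constants and composition do the rest. *)
Lemma carlitz_act_twist c u N y : u ^+ #|F| = iota c * u ->
  u * carlitz_act theta c iota N y = carlitz_act theta 1 iota N (u * y).
Proof.
move=> uq; elim/poly_ind: N y => [|N a IH] y; first by rewrite !carlitz_actr0 mulr0.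
rewrite !carlitz_actD mulrDr !carlitz_actM !carlitz_actC IH mulrCA.
congr (carlitz_act _ _ _ _ _ + _).
by rewrite !carlitz_actX rmorph1 exprMn uq; ring.
Qed.

End Twist.

Section Extension.

Variables (L : fieldType) (iota : {rmorphism {fraction {poly 'F_3}} -> L}) (i : L).
Hypothesis sqr_i : i ^+ 2 = -1.
Hypothesis hL : separable_closure iota.
Variable a : profinite_units 'F_3.

Local Notation A := {poly 'F_3}.
Local Notation K := {fraction A}.
Local Notation act := (carlitz_act (@tofrac A) 1 iota).
Local Notation evK f x := (map_poly iota f).[x].

Let alpha (N : modulus 'F_3) : A := lift_residue (component a N).

Let alpha_coprime N : coprimep (alpha N) (val N).
Proof.
have /unitrPr[b ab] := component_unit a N.
have /residue_eq/dvdpP[D E] : residue N (alpha N * lift_residue b) = residue N 1.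
  by rewrite residueM !lift_residueK residue1.
apply/Bezout_eq1_coprimepP; exists (lift_residue b, - D); rewrite /= mulNr -E; ring.
Qed.

Let act_eq N x y z : act N x = 0 -> N %| y - z -> act y x = act z x.
Proof.
move=> Nx /dvdpP[D E]; apply/eqP; rewrite -subr_eq0 -carlitz_actB E carlitz_actM Nx.
by rewrite carlitz_act0.
Qed.

Let alpha_compat (M N : modulus 'F_3) x : val M %| val N -> act (val M) x = 0 ->
  act (alpha N) x = act (alpha M) x.
Proof.
move=> MN Mx; apply: act_eq Mx _; apply/residue_eq.
by rewrite (component_compat a MN) lift_residueK.
Qed.

Definition conj_pair (k : nat) (N : modulus 'F_3) z (p0 p1 : {poly K}) : L * L :=
  horner_pair iota i ((-1) ^+ k * i) z (act (alpha N) z) p0 p1.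

(** The graph of i |-> (-1)^k i, z |-> C_a(z) on the ring generated over K by i and the Carlitz
    torsion, each element being written with a single torsion point. *)
Definition conj_graph k : set (L * L) :=
  [set v | exists N z p0 p1, act (val N) z = 0 /\ v = conj_pair k N z p0 p1]%classic.

(** A generator z of the torsion of level M1 M2 expresses both torsion points as C_r(z), and the
    compatibility of the components of a makes the prescribed images agree. *)
Lemma conj_graph_directed k v w : conj_graph k v -> conj_graph k w ->
  exists N z p0 p1 q0 q1, [/\ act (val N) z = 0, v = conj_pair k N z p0 p1
    & w = conj_pair k N z q0 q1].
Proof.
case=> M1 [z1 [p0 [p1 [Mz1 ->]]]] [M2 [z2 [q0 [q1 [Mz2 ->]]]]].
have [N NE] := modulus_mul M1 M2.
have [z zP gen] := torsion_cyclic (@tofrac_inj 'F_3) (oner_neq0 K) hL N.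
have Nz : act (val N) z = 0 by apply/zP.
have pair M y r0 r1 : val M %| val N -> act (val M) y = 0 ->
    exists s0 s1, conj_pair k M y r0 r1 = conj_pair k N z s0 s1.
  move=> MN My; have [|r yE] := gen y.
    have /dvdpP[D E] := MN; apply/eqP; rewrite -[LHS]/(act (val N) y) E carlitz_actM My.
    by rewrite carlitz_act0.
  exists (r0 \Po carlitz (@tofrac A) 1 r), (r1 \Po carlitz (@tofrac A) 1 r).
  rewrite /conj_pair -(alpha_compat MN My) yE -carlitz_actM [alpha N * r]mulrC carlitz_actM.
  exact: horner_pair_act.
have [|s0 [s1 ->]] := pair M1 z1 p0 p1 _ Mz1; first by rewrite NE dvdp_mulr.
have [|r0 [r1 ->]] := pair M2 z2 q0 q1 _ Mz2; first by rewrite NE dvdp_mull.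
by exists N, z, s0, s1, r0, r1.
Qed.

Lemma conj_graph_partial_hom k : partial_hom iota (conj_graph k).
Proof.
have sX : (1 < size ('X : A))%N by rewrite size_polyX.
split.
- move=> c; exists (mk_modulus sX), 0, c%:P, 0; split; first exact: carlitz_act0.
  exact/esym/horner_pairC.
- move=> v w Gv Gw.
  have [N [z [p0 [p1 [q0 [q1 [Nz -> ->]]]]]]] := conj_graph_directed Gv Gw.
  by exists N, z, (p0 - q0), (p1 - q1); split=> //; exact: horner_pairB.
- move=> v w Gv Gw.
  have [N [z [p0 [p1 [q0 [q1 [Nz -> ->]]]]]]] := conj_graph_directed Gv Gw.
  exists N, z, (p0 * q0 - p1 * q1), (p0 * q1 + p1 * q0); split=> //.
  apply: horner_pairM => //.
  by rewrite exprMn sqr_i -exprM mulnC exprM sqrrN !expr1n mul1r.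
(* Single-valuedness is the arithmetic content: a relation between z and i persists for their
   prescribed images. *)
- move=> y [N [z [p0 [p1 [Nz [/esym E ->]]]]]].
  apply: (conjugate_torsion sqr_i k _ Nz (alpha_coprime N) E).
  by rewrite -lead_coef_eq0 lead_modulus.
Qed.

Lemma galois_prescribed_torsion k : exists sigma : galois_group iota,
  sigma i = (-1) ^+ k * i /\
  forall (N : modulus 'F_3) z, act (val N) z = 0 -> sigma z = act (alpha N) z.
Proof.
have [sigma sigmaP] := partial_hom_extend hL (conj_graph_partial_hom k).
have sX : (1 < size ('X : A))%N by rewrite size_polyX.
exists sigma; split.
  apply: sigmaP; exists (mk_modulus sX), 0, 0, 1; split; first exact: carlitz_act0.
  exact/esym/horner_pairY.
move=> N z Nz; apply: sigmaP; exists N, z, 'X, 0; split=> //.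
exact/esym/horner_pairX.
Qed.

End Extension.

(** * The square root of the twist *)

(* With s = mu^2 and w = t + s, hyp is the equation C_Q(mu) / mu = 0 for
   Q = X^2 + X + 2, and s (1 - w - w^2) is the product of mu, C_X(mu), C_{X+1}(mu)
   and C_{X-1}(mu), representatives of the nonzero Q-torsion modulo sign. *)
Lemma sqr_half_torsion_product (R : comNzRingType) (s t w : R) :
  3%:R = 0 :> R -> w = t + s -> t * w + s * w ^+ 3 + w + 2%:R = 0 ->
  (s * (1 - w - w ^+ 2)) ^+ 2 = t ^+ 2 + t + 2%:R.
Proof.
move=> R3 -> hyp; apply/eqP; rewrite -subr_eq0; apply/eqP.
(* An identity over the integers: a multiple of the left side of [hyp] plus 3 times a polynomial. *)
transitivity ((- 1 - s + s * t + s ^+ 2) * (t * (t + s) + s * (t + s) ^+ 3 + (t + s) + 2%:R)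
  + 3%:R * (s - s ^+ 2 * t + s ^+ 2 * t ^+ 3 - s ^+ 3 + 3%:R * s ^+ 3 * t ^+ 2
            + 3%:R * s ^+ 4 * t + s ^+ 5)); first by ring.
by rewrite hyp R3 mulr0 mul0r addr0.
Qed.

Section Sqrt.

Variables (L : fieldType) (iota : {rmorphism {fraction {poly 'F_3}} -> L}).
Hypothesis hL : separable_closure iota.

Local Notation A := {poly 'F_3}.
Local Notation K := {fraction A}.
Local Notation theta := (@tofrac A).
Local Notation act := (carlitz_act theta 1 iota).
Local Notation t := (iota (tofrac 'X)).

Lemma X_torsion (c : K) : c != 0 ->
  exists x : L, [/\ x != 0, carlitz_act theta c iota 'X x = 0 & iota c * x ^+ 2 = - t].
Proof.
move=> c0; have sX : (1 < size ('X : A))%N by rewrite size_polyX.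
have [x x0 Xx] := torsion_nontrivial (@tofrac_inj 'F_3) c0 hL sX.
exists x; split=> //; apply: (mulIf x0); apply/eqP; rewrite mulNr -addr_eq0 addrC -mulrA -exprSr.
by apply/eqP; rewrite -[RHS]Xx carlitz_actX card_Fp.
Qed.

(** The X-torsion for c = 1 and for c = -1 provides square roots of -t and of t; their quotient is
    i. *)
Lemma sqrt_N1 : exists i : L, i ^+ 2 = -1.
Proof.
have [x [x0 _]] := X_torsion (oner_neq0 K); rewrite rmorph1 mul1r => xt.
have N1 : -1 != 0 :> K by rewrite oppr_eq0 oner_neq0.
have [y [_ _]] := X_torsion N1; rewrite rmorphN1 mulN1r => /oppr_inj yt.
exists (y / x); rewrite expr_div_n yt -[t]opprK -xt mulNr divff //.
by rewrite expf_neq0.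
Qed.

(* The last clause stands for: w lies in the field generated by the Carlitz torsion. *)
Lemma sqrt_twist (i : L) : i ^+ 2 = -1 -> exists w : L,
  [/\ i * w != 0, (i * w) ^+ 2 = iota twist &
    forall sigma tau : galois_group iota,
      (forall (N : modulus 'F_3) z, act (val N) z = 0 -> sigma z = tau z) ->
      sigma w = tau w].
Proof.
move=> i2; have [lam [lam0 Xlam]] := X_torsion (oner_neq0 K).
rewrite rmorph1 mul1r => lam2.
pose Q : A := 'X^2 + 'X + 2%:R%:P.
have sX : (1 < size ('X : A))%N by rewrite size_polyX.
have sQ : (1 < size Q)%N.
  rewrite /Q -addrA size_polyDl size_polyXn // ltnS (leq_trans (size_polyD _ _)) //.
  by rewrite geq_max size_polyX (leq_trans (size_polyC_leq1 _)).
have [mu mu0 Qmu] := torsion_nontrivial (@tofrac_inj 'F_3) (oner_neq0 K) hL sQ.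
pose nu := t * mu + mu ^+ 3.
have nuE : act 'X mu = nu by rewrite carlitz_actX rmorph1 mul1r card_Fp.
(* Equal to mu nu (nu + mu) (nu - mu) once C_Q(mu) = 0 is used to lower the degree. *)
pose pi := mu ^+ 2 - mu * nu - nu ^+ 2.
have pi2 : pi ^+ 2 = t ^+ 2 + t + 2%:R.
  rewrite /pi (_ : nu = mu * (t + mu ^+ 2)); last by rewrite /nu; ring.
  rewrite (_ : mu ^+ 2 - _ - _ =
      mu ^+ 2 * (1 - (t + mu ^+ 2) - (t + mu ^+ 2) ^+ 2)); last by ring.
  apply: sqr_half_torsion_product => //; first exact: three_eq0.
  apply: (mulfI mu0); rewrite mulr0 -[RHS]Qmu /Q expr2 !carlitz_actD carlitz_actM.
  rewrite carlitz_actC nuE carlitz_actX rmorph1 mul1r card_Fp // !rmorph_nat.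
  by rewrite /nu; ring.
have t0 : t != 0 by rewrite fmorph_eq0 tofrac_eq0 polyX_eq0.
have t1 : t + 1 != 0.
  rewrite -(rmorph1 iota) -rmorphD fmorph_eq0 -(rmorph1 theta) -rmorphD tofrac_eq0.
  by rewrite -size_poly_eq0 -polyC1 size_XaddC.
have gE : iota (tofrac ('X * ('X + 1) : A)) = t * (t + 1).
  by rewrite !rmorphM !rmorphD !rmorph1.
have twistE : iota twist = (t ^+ 2 + t + 2%:R) / (t * (t + 1) ^+ 2).
  by rewrite /twist fmorph_div !(rmorphD, rmorphM, rmorphXn, rmorph1, rmorph_nat).
(* Here i^2 cancels the sign in lam^2 = -t, and t (t^2 + t + 2) / (t (t + 1))^2 is the twist. *)
have sqr_w : (i * (lam * pi / (t * (t + 1)))) ^+ 2 = iota twist.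
  rewrite twistE !exprMn i2 lam2 pi2 exprVn.
  by field; rewrite t0 t1.
exists (lam * pi / (t * (t + 1))); split=> //.
  by rewrite -sqrf_eq0 sqr_w fmorph_eq0 twist_neq0.
move=> sigma tau st.
have st_lam : sigma lam = tau lam by apply: (st (mk_modulus sX)).
have st_mu : sigma mu = tau mu by apply: (st (mk_modulus sQ)).
have st_nu : sigma nu = tau nu by rewrite -nuE !galois_act st_mu.
rewrite -gE /pi; move: (tofrac _) => g.
by rewrite !(rmorphM, rmorphB, rmorphXn) !fmorphV !gal_fix /= st_lam st_mu st_nu.
Qed.

End Sqrt.

(** * Surjectivity of the adelic representation *)

Theorem proposition6p1 (Ksep : fieldType)
    (iota : {rmorphism {fraction {poly 'F_3}} -> Ksep})
    (hsep : separable_closure iota) :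
  forall a : profinite_units 'F_3, exists sigma : galois_group iota,
    carlitz_adelic_representation twist_neq0 hsep sigma = a.
Proof.
move=> a; have [i i2] := sqrt_N1 hsep.
have [w [u0 u2 st]] := sqrt_twist hsep i2; set u := i * w in u0 u2.
have [sigma [sigma_u sigmaP]] : exists sigma : galois_group iota, sigma u = u /\
    forall (N : modulus 'F_3) z, carlitz_act (@tofrac _) 1 iota (val N) z = 0 ->
      sigma z = carlitz_act (@tofrac _) 1 iota (lift_residue (component a N)) z.
  have [s0 [s0i s0P]] := galois_prescribed_torsion i2 hsep a 0.
  have [s1 [s1i s1P]] := galois_prescribed_torsion i2 hsep a 1.
  have s01 : s0 w = s1 w by apply: st => N z Nz; rewrite (s0P N) // (s1P N).
  have s0u : s0 u = i * s0 w by rewrite rmorphM s0i expr0 mul1r.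
  have s1u : s1 u = - s0 u by rewrite rmorphM s1i expr1 mulN1r mulNr -s01 s0u.
  (* As u^2 lies in K, s0 sends u to u or to -u; in the second case s1 fixes u. *)
  have /eqP : s0 u ^+ 2 = u ^+ 2 by rewrite -rmorphXn u2 gal_fix.
  rewrite eqf_sqr => /orP[/eqP E|/eqP E]; first by exists s0.
  by exists s1; split; first rewrite s1u E opprK.
exists sigma; apply: profinite_units_eq => N /=.
rewrite -[LHS]lift_residueK -[RHS]lift_residueK.
apply/(torsion_act_eq (@tofrac_inj 'F_3) twist_neq0 hsep) => x Nx.
(* For a torsion point x of rho^c, u x is Carlitz torsion, on which sigma acts through a; since
   sigma fixes u, it acts on x in the same way. *)
have uq : u ^+ #|'F_3| = iota twist * u by rewrite card_Fp // exprSr u2.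
rewrite -(torsion_charP (@tofrac_inj 'F_3) twist_neq0 hsep sigma Nx).
apply: (mulfI u0); rewrite (carlitz_act_twist _ _ _ uq) -[in LHS]sigma_u -rmorphM (sigmaP N) //.
by move: Nx; rewrite -(carlitz_act_twist _ _ _ uq) torsionE => /eqP->; rewrite mulr0.
Qed.
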